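(* Suppose Assumption A holds. Then $\overline{\mathrm{conv}(S)}\subseteq\widetilde{\mathrm{TH}}_k(\tilde G)$ for every integer $k\ge1$, the sets $\widetilde{\mathrm{TH}}_k(\tilde G)$ are decreasing in $k$, and $$\overline{\mathrm{conv}(S)}=\bigcap_{k=1}^\infty\widetilde{\mathrm{TH}}_k(\tilde G).$$
   Context: $X=(X_1,\dots,X_n)$, $\tilde X=(X_0,X_1,\dots,X_n)$, $\|\cdot\|_2$ Euclidean norm. For $f\in\mathbb{R}[X]$ of degree $d$, its homogenization is $\tilde f(\tilde X)=X_0^df(X/X_0)\in\mathbb{R}[\tilde X]$. Fix $g_1,\dots,g_m\in\mathbb{R}[X]$ and $S=\{x\in\mathbb{R}^n:g_1(x)\ge0,\dots,g_m(x)\ge0\}$. Define $\tilde S^{o}=\{\tilde x=(x_0,x)\in\mathbb{R}^{n+1}:\tilde g_j(\tilde x)\ge0\ (j=1,\dots,m),\ x_0>0\}$, $\tilde S^{c}$ the same set with $x_0\ge0$ in place of $x_0>0$, and $\tilde S=\tilde S^c\cap\{\|\tilde x\|_2=1\}$. $S$ is closed at $\infty$ if $\overline{\tilde S^{o}}=\tilde S^{c}$. For a finite set $H=\{h_1,\dots,h_r\}$ of polynomials, the $k$-th quadratic module is $\mathcal{Q}_k(H)=\{\sum_{j=0}^r\sigma_jh_j:h_0=1,\ \sigma_j\text{ sums of squares of polynomials},\ \deg(\sigma_jh_j)\le2k\}$. Let $\tilde G=\{\tilde g_1,\dots,\tilde g_m,X_0,\|\tilde X\|_2^2-1,1-\|\tilde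 X\|_2^2\}$. Let $\mathcal{P}[\tilde X]_1$ be the set of linear forms (homogeneous of degree one) in $\tilde X$ together with $0$. The modified theta body is $\widetilde{\mathrm{TH}}_k(\tilde G)=\{x\in\mathbb{R}^n:\tilde l(1,x)\ge0\ \forall\tilde l\in\mathcal{Q}_k(\tilde G)\cap\mathcal{P}[\tilde X]_1\}$. A closed convex cone $K$ is pointed if $K\cap(-K)=\{0\}$. Assumption A: (i) $S$ is closed at $\infty$; (ii) the convex cone $\mathrm{conv}(\overline{\tilde S^{o}})$ is closed and pointed. $\mathrm{conv}$ denotes convex hull, overline closure. *)

(* Defs.v *)
From Stdlib Require Import Reals Lra List Arith.
Import ListNotations.
Open Scope R_scope.

(* Multivariate real polynomials, represented by lists of monomials.       *)
(* A monomial (c, a) with a = [a_0; a_1; ...] denotes c * x_0^a_0 * ...    *)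
(* Variables are indexed by position.  Polynomials are compared as         *)
(* functions (peq), which over R is the same as equality in R[X].          *)

Definition mono := (R * list nat)%type.
Definition mpoly := list mono.

Definition meval (a : list nat) (x : list R) : R :=
  fold_right Rmult 1 (map (fun i => (nth i x 0) ^ (nth i a 0%nat)) (seq 0 (length a))).

Definition peval (p : mpoly) (x : list R) : R :=
  fold_right (fun m acc => fst m * meval (snd m) x + acc) 0 p.

Definition peq (p q : mpoly) : Prop := forall x : list R, peval p x = peval q x.

Definition mdeg (a : list nat) : nat := fold_right Nat.add 0%nat a.

Definition poly_in (N : nat) (p : mpoly) : Prop :=
  Forall (fun m => (length (snd m) <= N)%nat) p.

Fixpoint addexp (a b : list nat) : list nat :=
  match a, b with
  | [], b => b
  | a, [] => a
  | x :: a', y :: b' => (x + y)%nat :: addexp a' b'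
  end.

Definition padd (p q : mpoly) : mpoly := p ++ q.
Definition pmul (p q : mpoly) : mpoly :=
  flat_map (fun m1 => map (fun m2 => (fst m1 * fst m2, addexp (snd m1) (snd m2))) q) p.
Definition pscale (c : R) (p : mpoly) : mpoly := map (fun m => (c * fst m, snd m)) p.
Definition psum (ps : list mpoly) : mpoly := fold_right padd [] ps.
Definition pconst (c : R) : mpoly := [(c, [])].

Definition evar (i : nat) (e : nat) : list nat := repeat 0%nat i ++ [e].

Definition deg_le (p : mpoly) (d : nat) : Prop :=
  exists q, peq p q /\ Forall (fun m => (mdeg (snd m) <= d)%nat) q.

(* deg p = d (the zero polynomial has degree 0 by this convention) *)
Definition deg_exact (p : mpoly) (d : nat) : Prop :=
  deg_le p d /\ forall d', deg_le p d' -> (d <= d')%nat.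

(* Homogenization: X_0^d f(X/X_0), d = deg f.  A polynomial f in X_1..X_n
   uses positions 0..n-1; its homogenization in (X_0, X_1, ..., X_n) uses
   position 0 for X_0 and position i for X_i. *)
Definition homogenize (d : nat) (q : mpoly) : mpoly :=
  map (fun m => (fst m, (d - mdeg (snd m))%nat :: snd m)) q.

Definition homog_of (f F : mpoly) : Prop :=
  exists (q : mpoly) (d : nat),
    deg_exact f d /\ peq f q /\ Forall (fun m => (mdeg (snd m) <= d)%nat) q /\
    F = homogenize d q.

Definition sos (N : nat) (s : mpoly) : Prop :=
  exists qs : list mpoly, Forall (poly_in N) qs /\ peq s (psum (map (fun q => pmul q q) qs)).

Definition Qmod (N k : nat) (H : list mpoly) (p : mpoly) : Prop :=
  exists (s0 : mpoly) (ss : list mpoly),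
    sos N s0 /\ deg_le s0 (2 * k) /\
    Forall2 (fun s h => sos N s /\ deg_le (pmul s h) (2 * k)) ss H /\
    peq p (padd s0 (psum (map (fun sh => pmul (fst sh) (snd sh)) (combine ss H)))).

Definition linform (a : list R) : mpoly :=
  map (fun i => (nth i a 0, evar i 1)) (seq 0 (length a)).

(* Points of R^N: lists of length N.                                      *)

Definition rsum (l : list R) : R := fold_right Rplus 0 l.

Definition vdist2 (N : nat) (x y : list R) : R :=
  rsum (map (fun i => (nth i x 0 - nth i y 0) ^ 2) (seq 0 N)).

Definition closure (N : nat) (A : list R -> Prop) (x : list R) : Prop :=
  length x = N /\
  forall eps, 0 < eps -> exists y, A y /\ length y = N /\ sqrt (vdist2 N x y) < eps.

Definition conv (N : nat) (A : list R -> Prop) (x : list R) : Prop :=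
  length x = N /\
  exists ps : list (R * list R),
    Forall (fun wp => 0 <= fst wp /\ A (snd wp) /\ length (snd wp) = N) ps /\
    rsum (map fst ps) = 1 /\
    forall i, (i < N)%nat -> nth i x 0 = rsum (map (fun wp => fst wp * nth i (snd wp) 0) ps).

Definition is_closed (N : nat) (K : list R -> Prop) : Prop :=
  forall x, closure N K x -> K x.

Definition pointed (N : nat) (K : list R -> Prop) : Prop :=
  forall x, K x -> K (map Ropp x) -> forall i, (i < N)%nat -> nth i x 0 = 0.

Definition set_eq (A B : list R -> Prop) : Prop := forall x, A x <-> B x.

(* The sets of the paper.  g = [g_1; ...; g_m] in n variables, gt = their  *)
(* homogenizations in n+1 variables (X_0 at position 0).                   *)

Definition Sset (n : nat) (g : list mpoly) (x : list R) : Prop :=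
  length x = n /\ Forall (fun gj => 0 <= peval gj x) g.

Definition St_o (n : nat) (gt : list mpoly) (y : list R) : Prop :=
  length y = S n /\ Forall (fun h => 0 <= peval h y) gt /\ 0 < nth 0 y 0.

Definition St_c (n : nat) (gt : list mpoly) (y : list R) : Prop :=
  length y = S n /\ Forall (fun h => 0 <= peval h y) gt /\ 0 <= nth 0 y 0.

Definition closed_at_infinity (n : nat) (gt : list mpoly) : Prop :=
  set_eq (closure (S n) (St_o n gt)) (St_c n gt).

Definition assumptionA (n : nat) (gt : list mpoly) : Prop :=
  closed_at_infinity n gt /\
  is_closed (S n) (conv (S n) (closure (S n) (St_o n gt))) /\
  pointed (S n) (conv (S n) (closure (S n) (St_o n gt))).

Definition normsq (N : nat) : mpoly := map (fun i => (1, evar i 2)) (seq 0 N).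

Definition Gt (n : nat) (gt : list mpoly) : list mpoly :=
  gt ++ [ [(1, [1%nat])];
          padd (normsq (S n)) (pconst (-1));
          padd (pconst 1) (pscale (-1) (normsq (S n))) ].

Definition THk (n : nat) (gt : list mpoly) (k : nat) (x : list R) : Prop :=
  length x = n /\
  forall a : list R, length a = S n ->
    Qmod (S n) k (Gt n gt) (linform a) -> 0 <= peval (linform a) (1 :: x).

(* Main.v *)
Require Import Defs.
From Stdlib Require Import Reals Lra Lia Psatz List Arith Classical.
Import ListNotations.
Open Scope R_scope.

(** Let [K = conv (closure St_o)]. A point [x] outside [closure (conv S)] gives [(1, x)] outside
    the closed cone [K]; nearest-point separation, together with a functional positive on
    [K \ {0}] (which exists because [K] is pointed), produces a linear form [l] that is negative
    at [(1, x)] and positive on the unit vectors of [St_c]. It remains to show that such an [l]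
    lies in the quadratic module of [Gt], which is Putinar's theorem for the sphere.

    Put the constraints into a list [h_1, ..., h_m], including [-(|x|^2 - 1)^2], scaled so that
    [h_j <= 1] on the cube [[-1, 1]^N]. For suitable [c] and [k] the polynomial
    [f = l - c sum_j h_j (1 - h_j)^(2k)] is positive on the whole cube. Each [1 + x_i] and
    [1 - x_i] is a sum of squares modulo [|x|^2 - 1], hence so are the Bernstein weights [w_p],
    which are products of these. In [f = sum_p w_p f], a certified modulus of continuity
    [f >= f(p) - e - c' |x - p|^2] and the variance [sum_p w_p |x - p|^2 = sum_i (1 - x_i^2) / D]
    show that [f] itself is a sum of squares modulo [|x|^2 - 1]. *)

(** * Finite sums and vectors *)

(** [S] may be unbounded; homogenizing moves its points to the unit sphere, which supplies the
    compactness that a Positivstellensatz requires. Points at infinity then appear with [X_0 = 0]: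
    separation controls [closure St_o], whereas the generators of [Gt] cut out [St_c], and
    closedness at infinity identifies the two. Strict positivity matters because it leaves the
    margin that every later estimate spends.

    The cube enters because the grid points of the Bernstein weights need not lie on the sphere, so
    [f] must be positive at them as well. The constraint [-(|x|^2 - 1)^2] is nonnegative only on the
    sphere: it makes every other point of the cube violate a constraint, and its own contribution is
    a multiple of [|x|^2 - 1], hence free. The Bernstein argument multiplies certificates, which is
    harmless modulo the sphere alone; this is why the [h_j] are subtracted before it starts. Degrees
    are never tracked: [k] is chosen once the finished identity is known. *)

Lemma rsum_app (l1 l2 : list R) : rsum (l1 ++ l2) = rsum l1 + rsum l2.
Proof. induction l1 as [|a l IH]; simpl; [|rewrite IH]; lra. Qed.

Lemma rsum_map_ext {A : Type} (f g : A -> R) (l : list A) :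
  (forall a, In a l -> f a = g a) -> rsum (map f l) = rsum (map g l).
Proof. intros H. f_equal. now apply map_ext_in. Qed.

Lemma rsum_map_plus {A : Type} (f g : A -> R) (l : list A) :
  rsum (map (fun a => f a + g a) l) = rsum (map f l) + rsum (map g l).
Proof. induction l as [|a l IH]; simpl; [|rewrite IH]; lra. Qed.

Lemma rsum_map_scal {A : Type} (c : R) (f : A -> R) (l : list A) :
  rsum (map (fun a => c * f a) l) = c * rsum (map f l).
Proof. induction l as [|a l IH]; simpl; [|rewrite IH]; lra. Qed.

Lemma rsum_map_le {A : Type} (f g : A -> R) (l : list A) :
  (forall a, In a l -> f a <= g a) -> rsum (map f l) <= rsum (map g l).
Proof.
  induction l as [|a l IH]; simpl; intros H; [lra|].
  assert (f a <= g a) by auto. assert (rsum (map f l) <= rsum (map g l)) by auto. lra.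
Qed.

Lemma rsum_map_nonneg {A : Type} (f : A -> R) (l : list A) :
  (forall a, In a l -> 0 <= f a) -> 0 <= rsum (map f l).
Proof.
  induction l as [|a l IH]; simpl; intros H; [lra|].
  assert (0 <= f a) by auto. assert (0 <= rsum (map f l)) by auto. lra.
Qed.

Lemma rsum_map_const {A : Type} (c : R) (l : list A) :
  rsum (map (fun _ => c) l) = INR (length l) * c.
Proof.
  induction l as [|a l IH]; [simpl; lra|]. cbn [map rsum fold_right length].
  rewrite S_INR. unfold rsum in IH. rewrite IH. lra.
Qed.

Lemma rsum_list_prod {A B : Type} (f : A -> B -> R) (l : list A) (l' : list B) :
  rsum (map (fun ab => f (fst ab) (snd ab)) (list_prod l l')) =
  rsum (map (fun a => rsum (map (f a) l')) l).
Proof.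
  induction l as [|a l IH]; simpl; [reflexivity|].
  rewrite map_app, rsum_app, IH, map_map. reflexivity.
Qed.

Lemma Rabs_le_inv (a b : R) : Rabs a <= b -> - b <= a <= b.
Proof. unfold Rabs. destruct Rcase_abs; lra. Qed.

Definition bsum (N : nat) (f : nat -> R) : R := rsum (map f (seq 0 N)).

Lemma bsum_S (N : nat) (f : nat -> R) : bsum (S N) f = bsum N f + f N.
Proof. unfold bsum. rewrite seq_S, map_app, rsum_app. simpl. lra. Qed.

Lemma bsum_ext (N : nat) (f g : nat -> R) :
  (forall i, (i < N)%nat -> f i = g i) -> bsum N f = bsum N g.
Proof. intros H. apply rsum_map_ext. intros i Hi%in_seq. apply H; lia. Qed.

Lemma bsum_plus (N : nat) (f g : nat -> R) :
  bsum N (fun i => f i + g i) = bsum N f + bsum N g.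
Proof. apply rsum_map_plus. Qed.

Lemma bsum_scal (N : nat) (c : R) (f : nat -> R) :
  bsum N (fun i => c * f i) = c * bsum N f.
Proof. apply rsum_map_scal. Qed.

Lemma bsum_le (N : nat) (f g : nat -> R) :
  (forall i, (i < N)%nat -> f i <= g i) -> bsum N f <= bsum N g.
Proof. intros H. apply rsum_map_le. intros i Hi%in_seq. apply H; lia. Qed.

Lemma bsum_nonneg (N : nat) (f : nat -> R) :
  (forall i, (i < N)%nat -> 0 <= f i) -> 0 <= bsum N f.
Proof. intros H. apply rsum_map_nonneg. intros i Hi%in_seq. apply H; lia. Qed.

Lemma bsum_const (N : nat) (c : R) : bsum N (fun _ => c) = INR N * c.
Proof. unfold bsum. now rewrite rsum_map_const, length_seq. Qed.

Lemma bsum_ge_term (N i : nat) (f : nat -> R) :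
  (forall j, (j < N)%nat -> 0 <= f j) -> (i < N)%nat -> f i <= bsum N f.
Proof.
  intros H; induction N as [|N IH]; intros Hi; [lia|]. rewrite bsum_S.
  assert (0 <= bsum N f) by (apply bsum_nonneg; auto).
  destruct (Nat.eq_dec i N) as [->|Hne]; [lra|].
  assert (f i <= bsum N f) by (apply IH; [auto|lia]).
  assert (0 <= f N) by auto. lra.
Qed.

Lemma bsum_split_term (N i : nat) (f : nat -> R) : (i < N)%nat ->
  bsum N f = bsum N (fun j => if Nat.eqb j i then 0 else f j) + f i.
Proof.
  induction N as [|N IH]; intros Hi; [lia|]. rewrite !bsum_S.
  destruct (Nat.eqb_spec N i) as [->|Hne]; [|rewrite IH by lia; ring].
  rewrite (bsum_ext i (fun j => if Nat.eqb j i then 0 else f j) f); [ring|].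
  intros j Hj. destruct (Nat.eqb_spec j i); [lia|easy].
Qed.

Lemma bsum_rsum {A : Type} (N : nat) (f : nat -> A -> R) (l : list A) :
  bsum N (fun i => rsum (map (f i) l)) = rsum (map (fun a => bsum N (fun i => f i a)) l).
Proof.
  induction N as [|N IH].
  - unfold bsum at 1. simpl. unfold bsum; simpl. rewrite rsum_map_const. lra.
  - rewrite bsum_S, IH, <- rsum_map_plus. apply rsum_map_ext. intros. now rewrite bsum_S.
Qed.

Definition vec (N : nat) (f : nat -> R) : list R := map f (seq 0 N).

Lemma length_vec (N : nat) (f : nat -> R) : length (vec N f) = N.
Proof. unfold vec. now rewrite length_map, length_seq. Qed.

Lemma nth_vec (N i : nat) (f : nat -> R) : (i < N)%nat -> nth i (vec N f) 0 = f i.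
Proof.
  intros Hi. unfold vec. rewrite nth_indep with (d' := f 0%nat) by now rewrite length_map, length_seq.
  rewrite map_nth, seq_nth by easy. reflexivity.
Qed.

Lemma vector_ext (N : nat) (x y : list R) : length x = N -> length y = N ->
  (forall i, (i < N)%nat -> nth i x 0 = nth i y 0) -> x = y.
Proof. intros Hx Hy H. apply (nth_ext x y 0 0); [congruence|]. rewrite Hx. exact H. Qed.

Definition dot (N : nat) (a x : list R) : R := bsum N (fun i => nth i a 0 * nth i x 0).

Definition normsqr (N : nat) (x : list R) : R := bsum N (fun i => nth i x 0 ^ 2).

(** Sup-norm neighbourhoods: estimates run coordinate by coordinate, and [close_of_dist] with
    [dist_of_close] shows that they define the same closure as the Euclidean distance. *)
Definition close (N : nat) (d : R) (x y : list R) : Prop :=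
  forall i, (i < N)%nat -> Rabs (nth i x 0 - nth i y 0) < d.

Lemma close_of_dist (N : nat) (d : R) (x y : list R) :
  sqrt (vdist2 N x y) < d -> close N d x y.
Proof.
  intros H i Hi. eapply Rle_lt_trans; [|exact H].
  rewrite <- sqrt_Rsqr_abs. apply sqrt_le_1_alt. unfold vdist2.
  rewrite Rsqr_pow2.
  apply (bsum_ge_term N i (fun i => (nth i x 0 - nth i y 0) ^ 2)); [|easy].
  intros; apply pow2_ge_0.
Qed.

Lemma dist_of_close (N : nat) (e : R) (x y : list R) : 0 < e ->
  close N (e / INR (S N)) x y -> sqrt (vdist2 N x y) < e.
Proof.
  (* Dividing by [S N] keeps the radius meaningful for [N = 0], and [N d^2 < ((N + 1) d)^2] gives
     strictness. *)
  intros He H. pose proof (lt_0_INR (S N) ltac:(lia)) as HN. set (d := e / INR (S N)) in *.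
  assert (Hd : 0 < d) by (now apply Rdiv_lt_0_compat).
  assert (HS : INR (S N) = INR N + 1) by apply S_INR.
  assert (Hed : e = (INR N + 1) * d) by (unfold d; rewrite HS in *; field; lra).
  pose proof (pos_INR N).
  rewrite <- (sqrt_pow2 e) by lra. apply sqrt_lt_1_alt. split.
  - apply (bsum_nonneg N (fun i => (nth i x 0 - nth i y 0) ^ 2)). intros; apply pow2_ge_0.
  - apply Rle_lt_trans with (bsum N (fun _ => d ^ 2)).
    + apply (bsum_le N (fun i => (nth i x 0 - nth i y 0) ^ 2)). intros i Hi.
      rewrite <- (pow2_abs (_ - _)). apply pow_incr. split; [apply Rabs_pos|]. now apply Rlt_le, H.
    + rewrite bsum_const, Hed. rewrite Rpow_mult_distr. assert (0 < d^2) by (apply pow_lt; lra). nra.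
Qed.

(** * Compactness *)

Definition box (N : nat) (M : R) (x : list R) : Prop :=
  length x = N /\ forall i, (i < N)%nat -> Rabs (nth i x 0) <= M.

(** Heine-Borel as an induction principle on sets. The supremum of the good right endpoints cannot
    lie short of [b], since a good neighbourhood of it reaches past it. *)
Lemma interval_induction (a b : R) (P : (R -> Prop) -> Prop) : a <= b ->
  (forall U V : R -> Prop, (forall t, U t -> V t) -> P V -> P U) ->
  (forall U V : R -> Prop, P U -> P V -> P (fun t => U t \/ V t)) ->
  (forall t, a <= t <= b -> exists d, 0 < d /\ P (fun s => Rabs (s - t) < d)) ->
  P (fun t => a <= t <= b).
Proof.
  intros Hab Psub Pun Ploc.
  set (E := fun s => a <= s <= b /\ P (fun t => a <= t <= s)).
  assert (Ea : E a).
  { split; [lra|]. destruct (Ploc a) as [d [Hd Pd]]; [lra|].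
    eapply Psub; [|exact Pd]. intros t Ht. simpl. replace (t - a) with 0 by lra. now rewrite Rabs_R0. }
  destruct (completeness E) as [c [Hub Hlub]].
  - exists b. intros s [Hs _]. lra.
  - now exists a.
  - assert (Hc : a <= c <= b).
    { split; [now apply Hub|]. apply Hlub. intros s [Hs _]. lra. }
    destruct (Ploc c Hc) as [d [Hd Pd]].
    assert (exists s, E s /\ c - d < s) as [s [[Hs Ps] Hcs]].
    { apply NNPP. intros Hn. assert (c <= c - d); [|lra]. apply Hlub. intros s Es.
      apply Rnot_lt_le. intros Hl. apply Hn. now exists s. }
    assert (Hall : forall u, u < c + d -> P (fun t => a <= t <= u)).
    { intros u Hu. eapply Psub; [|apply (Pun _ _ Ps Pd)]. intros t Ht. simpl.
      destruct (Rle_dec t s); [left; lra|right]. apply Rabs_def1; lra. }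
    destruct (Rlt_dec b (c + d)) as [Hb|Hb]; [apply Hall; lra|].
    exfalso. assert (E (c + d / 2)).
    { split; [lra|]. apply Hall; lra. }
    assert (c + d / 2 <= c) by now apply Hub. lra.
Qed.

(** The tube lemma, by induction on [N]: [interval_induction] treats the first coordinate, the
    induction hypothesis the others. *)
Lemma box_induction (N : nat) (M : R) (P : (list R -> Prop) -> Prop) : 0 <= M ->
  (forall U V : list R -> Prop, (forall x, U x -> V x) -> P V -> P U) ->
  (forall U V : list R -> Prop, P U -> P V -> P (fun x => U x \/ V x)) ->
  (forall x, box N M x -> exists d, 0 < d /\ P (fun y => length y = N /\ close N d x y)) ->
  P (box N M).
Proof.
  intros HM. revert P. induction N as [|N IH]; intros P Psub Pun Ploc.
  - destruct (Ploc []) as [d [Hd Pd]].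
    { split; [easy|]. intros; lia. }
    eapply Psub; [|exact Pd]. intros x [Hx _]. split; [easy|]. intros i Hi; lia.
  - set (slab := fun (I : R -> Prop) (U : list R -> Prop) y =>
                   length y = S N /\ I (nth 0 y 0) /\ U (tl y)).
    apply Psub with (V := slab (fun t => -M <= t <= M) (box N M)).
    { intros x [Hl Hx]. destruct x as [|t x]; [easy|]. split; [easy|]. simpl. split.
      - specialize (Hx 0%nat ltac:(lia)). simpl in Hx. revert Hx. unfold Rabs. destruct Rcase_abs; lra.
      - split; [simpl in Hl; lia|]. intros i Hi. apply (Hx (S i)); lia. }
    apply (interval_induction (-M) M (fun I => P (slab I (box N M)))); [lra| | |].
    + intros U V HUV. apply Psub. intros x (?&?&?); repeat split; auto; apply H1; auto.
    + intros U V HU HV. eapply Psub; [|apply (Pun _ _ HU HV)]. intros x (?&[?|?]&?); [left|right]; easy.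
    + intros t Ht.
      (* The property handed to the induction hypothesis asks for some width [d] of the slab over
         [U]. A union takes the smaller of two widths, so one width serves the whole box of
         remaining coordinates. *)
      apply (IH (fun U => exists d, 0 < d /\ P (slab (fun s => Rabs (s - t) < d) U))).
      * intros U V HUV [d [Hd Pd]]. exists d. split; [easy|]. eapply Psub; [|exact Pd].
        intros x (?&?&?). repeat split; auto.
      * intros U V [d [Hd Pd]] [d' [Hd' Pd']]. exists (Rmin d d').
        split; [now apply Rmin_glb_lt|]. eapply Psub; [|apply (Pun _ _ Pd Pd')].
        pose proof (Rmin_l d d'); pose proof (Rmin_r d d').
        intros x (?&?&[?|?]); [left|right]; repeat split; auto; lra.
      * intros x [Hl Hx]. destruct (Ploc (t :: x)) as [d [Hd Pd]].
        { split; [simpl; lia|]. intros [|i] Hi; simpl; [apply Rabs_le; lra|apply Hx; lia]. }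
        exists d. split; [easy|]. exists d. split; [easy|]. eapply Psub; [|exact Pd].
        intros y (Hly&Hy0&[Hly' Hy]). split; [easy|]. destruct y as [|s y]; [easy|].
        intros [|i] Hi; simpl in *; [now rewrite Rabs_minus_sym|]. apply Hy; lia.
Qed.

(** * Evaluation of polynomials *)

Lemma nth_tl (i : nat) (x : list R) : nth i (tl x) 0 = nth (S i) x 0.
Proof. destruct x; [now destruct i|reflexivity]. Qed.

Lemma meval_cons (k : nat) (a : list nat) (x : list R) :
  meval (k :: a) x = nth 0 x 0 ^ k * meval a (tl x).
Proof.
  unfold meval. cbn [length seq map fold_right]. f_equal. f_equal.
  rewrite <- seq_shift, map_map. apply map_ext. intros i. now rewrite nth_tl.
Qed.

Lemma meval_addexp (a b : list nat) (x : list R) :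
  meval (addexp a b) x = meval a x * meval b x.
Proof.
  revert b x. induction a as [|k a IH]; intros [|l b] x.
  - unfold meval; simpl; lra.
  - unfold meval at 2; simpl; lra.
  - simpl addexp. unfold meval at 3; simpl; lra.
  - simpl addexp. rewrite !meval_cons, IH, pow_add. lra.
Qed.

Lemma meval_evar (i e : nat) (x : list R) : meval (evar i e) x = nth i x 0 ^ e.
Proof.
  unfold evar. revert x. induction i as [|i IH]; intros x; simpl repeat.
  - simpl app. rewrite meval_cons. unfold meval; simpl; lra.
  - simpl app. rewrite meval_cons, IH, nth_tl. simpl; lra.
Qed.

Lemma peval_app (p q : mpoly) (x : list R) : peval (p ++ q) x = peval p x + peval q x.
Proof.
  induction p as [|m p IH]; [simpl; lra|].
  change (peval ((m :: p) ++ q) x) with (fst m * meval (snd m) x + peval (p ++ q) x).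
  change (peval (m :: p) x) with (fst m * meval (snd m) x + peval p x). lra.
Qed.

Lemma peval_rsum (p : mpoly) (x : list R) :
  peval p x = rsum (map (fun m => fst m * meval (snd m) x) p).
Proof. induction p as [|m p IH]; simpl; [easy|]. now rewrite IH. Qed.

Lemma peval_pscale (c : R) (p : mpoly) (x : list R) : peval (pscale c p) x = c * peval p x.
Proof.
  unfold pscale. rewrite !peval_rsum, map_map, <- rsum_map_scal. apply rsum_map_ext.
  intros; simpl; lra.
Qed.

Lemma peval_pmul (p q : mpoly) (x : list R) : peval (pmul p q) x = peval p x * peval q x.
Proof.
  induction p as [|m p IH]; [simpl; lra|].
  change (pmul (m :: p) q) with
    (map (fun m2 => (fst m * fst m2, addexp (snd m) (snd m2))) q ++ pmul p q).
  rewrite peval_app, IH.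
  change (peval (m :: p) x) with (fst m * meval (snd m) x + peval p x).
  rewrite (peval_rsum (map _ q)), map_map, (peval_rsum q), Rmult_plus_distr_r. f_equal.
  rewrite <- rsum_map_scal. apply rsum_map_ext. intros; simpl. rewrite meval_addexp. lra.
Qed.

Lemma peval_pconst (c : R) (x : list R) : peval (pconst c) x = c.
Proof. unfold pconst, peval, meval; simpl; lra. Qed.

Lemma peval_psum (ps : list mpoly) (x : list R) :
  peval (psum ps) x = rsum (map (fun p => peval p x) ps).
Proof. induction ps as [|p ps IH]; simpl; [easy|]. unfold padd. now rewrite peval_app, IH. Qed.

Lemma peval_linform (a x : list R) : peval (linform a) x = dot (length a) a x.
Proof.
  unfold linform. rewrite peval_rsum, map_map. apply rsum_map_ext.
  intros i _. cbn [fst snd]. rewrite meval_evar. lra.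
Qed.

Lemma peval_normsq (N : nat) (x : list R) : peval (normsq N) x = normsqr N x.
Proof.
  unfold normsq. rewrite peval_rsum, map_map. apply rsum_map_ext.
  intros i _. cbn [fst snd]. rewrite meval_evar. lra.
Qed.

Lemma deg_le_weaken (p : mpoly) (d d' : nat) : (d <= d')%nat -> deg_le p d -> deg_le p d'.
Proof.
  intros Hd [q [Hq H]]. exists q. split; [easy|]. eapply Forall_impl; [|exact H].
  simpl; intros; lia.
Qed.

Lemma deg_le_exists (p : mpoly) : exists d, deg_le p d.
Proof.
  assert (exists d, Forall (fun m => (mdeg (snd m) <= d)%nat) p) as [d Hd].
  { induction p as [|m p [d IH]]; [now exists 0%nat|].
    exists (Nat.max d (mdeg (snd m))). constructor; [lia|].
    eapply Forall_impl; [|exact IH]. simpl; intros; lia. }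
  exists d, p. split; [intros x; reflexivity|easy].
Qed.

(** * Polynomial functions *)

(** Functions instead of monomial lists allow induction on how a polynomial is built; the last
    constructor stands in for functional extensionality. *)
Inductive polyfun (N : nat) : (list R -> R) -> Prop :=
| polyfun_const (c : R) : polyfun N (fun _ => c)
| polyfun_var (i : nat) : (i < N)%nat -> polyfun N (fun x => nth i x 0)
| polyfun_add (f g : list R -> R) :
    polyfun N f -> polyfun N g -> polyfun N (fun x => f x + g x)
| polyfun_mul (f g : list R -> R) :
    polyfun N f -> polyfun N g -> polyfun N (fun x => f x * g x)
| polyfun_ext (f g : list R -> R) : polyfun N f -> (forall x, f x = g x) -> polyfun N g.

Lemma polyfun_scal (N : nat) (c : R) (f : list R -> R) :
  polyfun N f -> polyfun N (fun x => c * f x).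
Proof. intros H. apply polyfun_mul; [apply polyfun_const|easy]. Qed.

Lemma polyfun_sub (N : nat) (f g : list R -> R) :
  polyfun N f -> polyfun N g -> polyfun N (fun x => f x - g x).
Proof.
  intros Hf Hg. eapply polyfun_ext.
  - apply (polyfun_add N _ _ Hf (polyfun_scal N (-1) _ Hg)).
  - intros; simpl; lra.
Qed.

Lemma polyfun_pow (N k : nat) (f : list R -> R) : polyfun N f -> polyfun N (fun x => f x ^ k).
Proof.
  intros H. induction k as [|k IH]; simpl; [apply polyfun_const|]. now apply polyfun_mul.
Qed.

Lemma polyfun_rsum {A : Type} (N : nat) (F : A -> list R -> R) (l : list A) :
  (forall a, In a l -> polyfun N (F a)) -> polyfun N (fun x => rsum (map (fun a => F a x) l)).
Proof.
  induction l as [|a l IH]; simpl; intros H; [apply polyfun_const|].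
  apply (polyfun_add N (F a) (fun x => rsum (map (fun a => F a x) l))); auto.
Qed.

Lemma polyfun_bsum (N M : nat) (F : nat -> list R -> R) :
  (forall i, (i < M)%nat -> polyfun N (F i)) -> polyfun N (fun x => bsum M (fun i => F i x)).
Proof. intros H. apply polyfun_rsum. intros i Hi%in_seq. apply H; lia. Qed.

Lemma polyfun_normsqr (N : nat) : polyfun N (normsqr N).
Proof. apply polyfun_bsum. intros i Hi. apply polyfun_pow, polyfun_var, Hi. Qed.

Lemma polyfun_dot (N : nat) (a : list R) : polyfun N (dot N a).
Proof. apply polyfun_bsum. intros i Hi. apply polyfun_scal, polyfun_var, Hi. Qed.

(** The freedom in [T] serves the truncation to finitely many coordinates in [homog_of_homogenizes],
    where the monomials may mention further variables. *)
Lemma polyfun_peval_with (N : nat) (T : list R -> list R) (p : mpoly) :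
  (forall m i, In m p -> (i < length (snd m))%nat -> polyfun N (fun x => nth i (T x) 0)) ->
  polyfun N (fun x => peval p (T x)).
Proof.
  intros H. eapply polyfun_ext; [|intros x; symmetry; apply peval_rsum].
  apply (polyfun_rsum N (fun m x => fst m * meval (snd m) (T x))). intros m Hm.
  apply polyfun_scal. unfold meval.
  assert (Hi : forall i, In i (seq 0 (length (snd m))) -> polyfun N (fun x => nth i (T x) 0)).
  { intros i Hi%in_seq. apply (H m); [easy|lia]. }
  revert Hi. generalize (seq 0 (length (snd m))) as l.
  induction l as [|i l IH]; simpl; intros Hi; [apply polyfun_const|].
  apply polyfun_mul; [apply polyfun_pow, Hi; auto|apply IH; auto].
Qed.

Lemma length_addexp (a b : list nat) : length (addexp a b) = Nat.max (length a) (length b).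
Proof. revert b; induction a as [|k a IH]; intros [|l b]; simpl; try lia. now rewrite IH. Qed.

Lemma polyfun_repr (N : nat) (f : list R -> R) : polyfun N f ->
  exists p, poly_in N p /\ forall x, peval p x = f x.
Proof.
  induction 1 as [c|i Hi|f g _ [p [Hp Hf]] _ [q [Hq Hg]]|f g _ [p [Hp Hf]] _ [q [Hq Hg]]
                 |f g _ [p [Hp Hf]] Hfg].
  - exists (pconst c). split; [repeat constructor; simpl; lia|]. apply peval_pconst.
  - exists [(1, evar i 1)]. split.
    + repeat constructor. unfold evar. simpl. rewrite length_app, repeat_length. simpl; lia.
    + intros x. unfold peval. simpl fold_right. rewrite meval_evar. simpl; lra.
  - exists (padd p q). split; [now apply Forall_app|].
    intros x. unfold padd. now rewrite peval_app, Hf, Hg.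
  - exists (pmul p q). split.
    + unfold poly_in, pmul in *. rewrite Forall_forall in *. intros m Hm%in_flat_map.
      destruct Hm as [m1 [H1 H2]]. apply in_map_iff in H2. destruct H2 as [m2 [<- H2]].
      simpl. rewrite length_addexp. specialize (Hp _ H1). specialize (Hq _ H2). simpl in *. lia.
    + intros x. now rewrite peval_pmul, Hf, Hg.
  - exists p. split; [easy|]. intros x. now rewrite Hf.
Qed.

Lemma polyfun_continuous (N : nat) (f : list R -> R) : polyfun N f -> forall x e, 0 < e ->
  exists d, 0 < d /\ forall y, close N d x y -> Rabs (f x - f y) < e.
Proof.
  induction 1 as [c|i Hi|f g _ IHf _ IHg|f g _ IHf _ IHg|f g _ IH Hfg]; intros x e He.
  - exists 1. split; [lra|]. intros y _. now rewrite Rminus_diag, Rabs_R0.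
  - exists e. split; [easy|]. intros y Hy. now apply Hy.
  - destruct (IHf x (e / 2)) as [d [Hd Hf]]; [lra|].
    destruct (IHg x (e / 2)) as [d' [Hd' Hg]]; [lra|].
    exists (Rmin d d'). split; [now apply Rmin_glb_lt|]. intros y Hy.
    pose proof (Rmin_l d d'); pose proof (Rmin_r d d').
    assert (Rabs (f x - f y) < e / 2).
    { apply Hf. intros i Hi. specialize (Hy i Hi). lra. }
    assert (Rabs (g x - g y) < e / 2).
    { apply Hg. intros i Hi. specialize (Hy i Hi). lra. }
    replace (f x + g x - (f y + g y)) with ((f x - f y) + (g x - g y)) by ring.
    eapply Rle_lt_trans; [apply Rabs_triang|lra].
  (* Since [h <= 1], the three terms of the product expansion sum to at most
     [h (|f x| + |g x| + 1) < h A <= e]. *)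
  - set (A := Rabs (f x) + Rabs (g x) + 2).
    assert (HA : 0 < A) by (unfold A; pose proof (Rabs_pos (f x)); pose proof (Rabs_pos (g x)); lra).
    set (h := Rmin 1 (e / A)).
    assert (Hh : 0 < h) by (apply Rmin_glb_lt; [lra|now apply Rdiv_lt_0_compat]).
    assert (Hh1 : h <= 1) by apply Rmin_l.
    assert (HhA : h * A <= e).
    { apply Rle_trans with (e / A * A); [|right; field; lra].
      apply Rmult_le_compat_r; [lra|apply Rmin_r]. }
    destruct (IHf x h Hh) as [d [Hd Hf]]. destruct (IHg x h Hh) as [d' [Hd' Hg]].
    exists (Rmin d d'). split; [now apply Rmin_glb_lt|]. intros y Hy.
    pose proof (Rmin_l d d'); pose proof (Rmin_r d d').
    assert (H1 : Rabs (f x - f y) < h).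
    { apply Hf. intros i Hi. specialize (Hy i Hi). lra. }
    assert (H2 : Rabs (g x - g y) < h).
    { apply Hg. intros i Hi. specialize (Hy i Hi). lra. }
    replace (f x * g x - f y * g y)
      with (f x * (g x - g y) + g x * (f x - f y) + - ((f x - f y) * (g x - g y))) by ring.
    eapply Rle_lt_trans; [apply Rabs_triang|]. rewrite Rabs_Ropp.
    eapply Rle_lt_trans; [apply Rplus_le_compat_r, Rabs_triang|]. rewrite !Rabs_mult.
    pose proof (Rabs_pos (f x)); pose proof (Rabs_pos (g x)).
    pose proof (Rabs_pos (f x - f y)); pose proof (Rabs_pos (g x - g y)).
    unfold A in *. nra.
  - destruct (IH x e He) as [d [Hd Hf]]. exists d. split; [easy|]. intros y Hy.
    rewrite <- !Hfg. now apply Hf.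
Qed.

(** * Sums of squares modulo the sphere *)

Inductive sosfun (N : nat) : (list R -> R) -> Prop :=
| sosfun_sq (q : list R -> R) : polyfun N q -> sosfun N (fun x => q x * q x)
| sosfun_add (f g : list R -> R) : sosfun N f -> sosfun N g -> sosfun N (fun x => f x + g x)
| sosfun_ext (f g : list R -> R) : sosfun N f -> (forall x, f x = g x) -> sosfun N g.

Lemma sosfun_polyfun (N : nat) (f : list R -> R) : sosfun N f -> polyfun N f.
Proof.
  induction 1 as [q Hq|f g _ IHf _ IHg|f g _ IH Hfg].
  - now apply polyfun_mul.
  - now apply polyfun_add.
  - eapply polyfun_ext; eassumption.
Qed.

Lemma sosfun_const (N : nat) (c : R) : 0 <= c -> sosfun N (fun _ => c).
Proof.
  intros Hc. eapply sosfun_ext; [apply (sosfun_sq N _ (polyfun_const N (sqrt c)))|].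
  intros x. now apply sqrt_sqrt.
Qed.

Lemma sosfun_mul (N : nat) (f g : list R -> R) :
  sosfun N f -> sosfun N g -> sosfun N (fun x => f x * g x).
Proof.
  induction 1 as [q Hq|f1 f2 _ IH1 _ IH2|f1 f2 _ IH Hf]; intros Hg.
  - induction Hg as [r Hr|g1 g2 _ IH1 _ IH2|g1 g2 _ IH Hg'].
    + eapply sosfun_ext; [apply (sosfun_sq N _ (polyfun_mul N _ _ Hq Hr))|]. intros; simpl; ring.
    + eapply sosfun_ext; [apply (sosfun_add N _ _ IH1 IH2)|]. intros; simpl; ring.
    + eapply sosfun_ext; [exact IH|]. intros; simpl. now rewrite Hg'.
  - eapply sosfun_ext; [apply (sosfun_add N _ _ (IH1 Hg) (IH2 Hg))|]. intros; simpl; ring.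
  - eapply sosfun_ext; [exact (IH Hg)|]. intros; simpl. now rewrite Hf.
Qed.

Lemma sosfun_bsum (N M : nat) (F : nat -> list R -> R) :
  (forall i, (i < M)%nat -> sosfun N (F i)) -> sosfun N (fun x => bsum M (fun i => F i x)).
Proof.
  induction M as [|M IH]; intros H; [apply (sosfun_const N 0); lra|].
  eapply sosfun_ext; [apply (sosfun_add N _ (F M) (IH ltac:(auto)) ltac:(auto))|].
  intros; simpl. now rewrite bsum_S.
Qed.

Lemma sosfun_sos (N : nat) (f : list R -> R) (p : mpoly) :
  sosfun N f -> (forall x, peval p x = f x) -> sos N p.
Proof.
  intros Hf Hp.
  assert (exists qs, Forall (poly_in N) qs /\
            forall x, f x = peval (psum (map (fun q => pmul q q) qs)) x) as [qs [Hqs H]].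
  { clear Hp. induction Hf as [q Hq|f1 f2 _ [qs [Hqs H1]] _ [rs [Hrs H2]]|f1 f2 _ [qs [Hqs H1]] Hfg].
    - destruct (polyfun_repr N q Hq) as [r [Hr Hrq]]. exists [r]. split; [now constructor|].
      intros x. rewrite peval_psum. simpl. rewrite peval_pmul, Hrq. ring.
    - exists (qs ++ rs). split; [now apply Forall_app|].
      intros x. rewrite H1, H2, !peval_psum, !map_app, rsum_app. reflexivity.
    - exists qs. split; [easy|]. intros x. now rewrite <- Hfg. }
  exists qs. split; [easy|]. intros x. now rewrite Hp, H.
Qed.

(** Sums of squares modulo the ideal of the sphere. The sign of [r] is free because [Gt] contains
    both [|x|^2 - 1] and its negative. Unlike a general quadratic module, this set is closed under
    products. *)
Definition cert (N : nat) (f : list R -> R) : Prop :=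
  exists s r, sosfun N s /\ polyfun N r /\ forall x, f x = s x + r x * (normsqr N x - 1).

Lemma cert_ext (N : nat) (f g : list R -> R) :
  cert N f -> (forall x, f x = g x) -> cert N g.
Proof. intros (s&r&Hs&Hr&H) Hfg. exists s, r. repeat split; auto. intros; now rewrite <- Hfg. Qed.

Lemma cert_sosfun (N : nat) (f : list R -> R) : sosfun N f -> cert N f.
Proof.
  intros H. exists f, (fun _ => 0). repeat split; [easy|apply polyfun_const|]. intros; ring.
Qed.

Lemma cert_const (N : nat) (c : R) : 0 <= c -> cert N (fun _ => c).
Proof. intros Hc. now apply cert_sosfun, sosfun_const. Qed.

Lemma cert_add (N : nat) (f g : list R -> R) :
  cert N f -> cert N g -> cert N (fun x => f x + g x).
Proof.
  intros (s&r&Hs&Hr&H) (s'&r'&Hs'&Hr'&H').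
  exists (fun x => s x + s' x), (fun x => r x + r' x).
  repeat split; [now apply sosfun_add|now apply polyfun_add|]. intros x. rewrite H, H'. ring.
Qed.

Lemma cert_mul (N : nat) (f g : list R -> R) :
  cert N f -> cert N g -> cert N (fun x => f x * g x).
Proof.
  intros (s&r&Hs&Hr&H) (s'&r'&Hs'&Hr'&H').
  exists (fun x => s x * s' x), (fun x => s x * r' x + r x * (s' x + r' x * (normsqr N x - 1))).
  assert (polyfun N s) by now apply sosfun_polyfun.
  assert (polyfun N s') by now apply sosfun_polyfun.
  repeat split; [now apply sosfun_mul| |].
  - apply polyfun_add; apply polyfun_mul; try easy. apply polyfun_add; [easy|].
    apply polyfun_mul; [easy|]. apply polyfun_sub; [apply polyfun_normsqr|apply polyfun_const].
  - intros x. rewrite H, H'. ring.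
Qed.

Lemma cert_scal (N : nat) (c : R) (f : list R -> R) :
  0 <= c -> cert N f -> cert N (fun x => c * f x).
Proof. intros Hc Hf. apply cert_mul; [now apply cert_const|easy]. Qed.

Lemma cert_rsum {A : Type} (N : nat) (F : A -> list R -> R) (l : list A) :
  (forall a, In a l -> cert N (F a)) -> cert N (fun x => rsum (map (fun a => F a x) l)).
Proof.
  induction l as [|a l IH]; simpl; intros H; [apply cert_const; lra|].
  apply (cert_add N (F a) (fun x => rsum (map (fun a => F a x) l))); auto.
Qed.

(* [1 + c x_i = ((1 + c x_i)^2 + sum_{j <> i} x_j^2) / 2] on the sphere when [c = 1] or [c = -1]. *)
Lemma cert_one_plus_var (N i : nat) (c : R) : c * c = 1 -> (i < N)%nat ->
  cert N (fun x => 1 + c * nth i x 0).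
Proof.
  intros Hc Hi.
  set (rest := fun x => bsum N (fun j => if Nat.eqb j i then 0 else nth j x 0 * nth j x 0)).
  assert (Hrest : forall x, normsqr N x = rest x + nth i x 0 * nth i x 0).
  { intros x. unfold rest, normsqr. rewrite (bsum_split_term N i) by easy. f_equal; [|ring].
    apply bsum_ext. intros j _. destruct (Nat.eqb j i); ring. }
  exists (fun x => /2 * ((1 + c * nth i x 0) * (1 + c * nth i x 0)) + /2 * rest x), (fun _ => - /2).
  repeat split.
  - apply sosfun_add; apply sosfun_mul; try (apply sosfun_const; lra).
    + apply sosfun_sq. apply polyfun_add; [apply polyfun_const|]. now apply polyfun_scal, polyfun_var.
    + apply (sosfun_bsum N N (fun j x => if Nat.eqb j i then 0 else nth j x 0 * nth j x 0)).
      intros j Hj. destruct (Nat.eqb j i); [apply sosfun_const; lra|].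
      apply sosfun_sq. now apply polyfun_var.
  - apply polyfun_const.
  - intros x. rewrite Hrest.
    replace ((1 + c * nth i x 0) * (1 + c * nth i x 0))
      with (1 + 2 * c * nth i x 0 + (c * c) * (nth i x 0 * nth i x 0)) by ring.
    rewrite Hc. lra.
Qed.

(** * Positive polynomials on the cube *)

(* [2 (b d + u e) = (b + u) (d + e) + (b - u) (d - e)]. *)
Lemma cert_mul_abs (N : nat) (b u d e : list R -> R) :
  cert N (fun x => b x + u x) -> cert N (fun x => b x - u x) ->
  cert N (fun x => d x + e x) -> cert N (fun x => d x - e x) ->
  cert N (fun x => b x * d x + u x * e x) /\ cert N (fun x => b x * d x - u x * e x).
Proof.
  intros H1 H2 H3 H4. split.
  - eapply cert_ext; [apply (cert_scal N (/2) _ ltac:(lra)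
      (cert_add N _ _ (cert_mul N _ _ H1 H3) (cert_mul N _ _ H2 H4)))|]. intros; simpl; field.
  - eapply cert_ext; [apply (cert_scal N (/2) _ ltac:(lra)
      (cert_add N _ _ (cert_mul N _ _ H1 H4) (cert_mul N _ _ H2 H3)))|]. intros; simpl; field.
Qed.

(** The Archimedean property, by induction on [f]. A certificate bounds [f] on the sphere only, so
    the bound on the cube, needed at grid points, is carried along with the same [b]. *)
Lemma cert_bounded (N : nat) (f : list R -> R) : polyfun N f ->
  exists b, 0 <= b /\ cert N (fun x => b + f x) /\ cert N (fun x => b - f x) /\
    forall p, box N 1 p -> Rabs (f p) <= b.
Proof.
  induction 1 as [c|i Hi|f g _ (b&Hb&H1&H2&H3) _ (b'&Hb'&H1'&H2'&H3')
    |f g _ (b&Hb&H1&H2&H3) _ (b'&Hb'&H1'&H2'&H3')|f g _ (b&Hb&H1&H2&H3) Hfg].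
  - exists (Rabs c). pose proof (Rabs_pos c). pose proof (Rle_abs c). pose proof (Rle_abs (- c)).
    rewrite Rabs_Ropp in *. repeat split; [easy|apply cert_const; lra|apply cert_const; lra|intros; lra].
  - exists 1. repeat split; [lra| | |].
    + eapply cert_ext; [apply (cert_one_plus_var N i 1); [lra|easy]|]. intros; simpl; lra.
    + eapply cert_ext; [apply (cert_one_plus_var N i (-1)); [lra|easy]|]. intros; simpl; lra.
    + intros p [_ Hp]. now apply Hp.
  - exists (b + b'). repeat split; [lra| | |].
    + eapply cert_ext; [apply (cert_add N _ _ H1 H1')|]. intros; simpl; ring.
    + eapply cert_ext; [apply (cert_add N _ _ H2 H2')|]. intros; simpl; ring.
    + intros p Hp. eapply Rle_trans; [apply Rabs_triang|]. specialize (H3 p Hp). specialize (H3' p Hp). lra.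
  - exists (b * b'). destruct (cert_mul_abs N (fun _ => b) f (fun _ => b') g) as [H4 H5]; try easy.
    repeat split; [now apply Rmult_le_pos|easy|easy|].
    intros p Hp. rewrite Rabs_mult. apply Rmult_le_compat; auto using Rabs_pos.
  - exists b. repeat split; [easy| | |].
    + eapply cert_ext; [exact H1|]. intros; simpl; now rewrite Hfg.
    + eapply cert_ext; [exact H2|]. intros; simpl; now rewrite Hfg.
    + intros p Hp. rewrite <- Hfg. auto.
Qed.

Definition sqdist (N : nat) (x p : list R) : R := bsum N (fun i => (nth i x 0 - nth i p 0) ^ 2).

Lemma cert_sqdist (N : nat) (p : list R) : cert N (fun x => sqdist N x p).
Proof.
  apply cert_sosfun. apply (sosfun_bsum N N (fun i x => (nth i x 0 - nth i p 0) ^ 2)).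
  intros i Hi. eapply sosfun_ext; [apply (sosfun_sq N (fun x => nth i x 0 - nth i p 0))|].
  - apply polyfun_sub; [now apply polyfun_var|apply polyfun_const].
  - intros; simpl; ring.
Qed.

(* A certified form of uniform continuity on the cube: [c] does not depend on [p]. *)
Lemma cert_modulus (N : nat) (f : list R -> R) : polyfun N f -> forall e, 0 < e ->
  exists c, 0 <= c /\ forall p, box N 1 p ->
    cert N (fun x => (e + c * sqdist N x p) + (f x - f p)) /\
    cert N (fun x => (e + c * sqdist N x p) - (f x - f p)).
Proof.
  induction 1 as [a|i Hi|f g Hf IHf Hg IHg|f g Hf IHf Hg IHg|f g _ IH Hfg]; intros e He.
  - exists 0. split; [lra|]. intros p _.
    split; (eapply cert_ext; [apply (cert_const N e); lra|]; intros; simpl; ring).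
  (* Completing the square in the coordinate difference [u]: [e + c u^2 + s u = e (1 + 2 c s u)^2]
     when [4 c e = 1] and [s^2 = 1]. *)
  - set (c := / (4 * e)). assert (Hc : 0 < c) by (apply Rinv_0_lt_compat; lra).
    assert (Hce : c * e = /4) by (unfold c; field; lra).
    exists c. split; [lra|]. intros p _.
    assert (Hrest : cert N (fun x => c * (sqdist N x p - (nth i x 0 - nth i p 0) ^ 2))).
    { apply cert_scal; [lra|].
      eapply cert_ext; [apply cert_sosfun,
        (sosfun_bsum N N (fun j x => if Nat.eqb j i then 0 else (nth j x 0 - nth j p 0) ^ 2))|].
      - intros j Hj. destruct (Nat.eqb j i); [apply sosfun_const; lra|].
        eapply sosfun_ext; [apply (sosfun_sq N (fun x => nth j x 0 - nth j p 0))|].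
        + apply polyfun_sub; [now apply polyfun_var|apply polyfun_const].
        + intros; simpl; ring.
      - intros x. cbn beta. unfold sqdist.
        rewrite (bsum_split_term N i (fun j => (nth j x 0 - nth j p 0) ^ 2)) by easy. ring. }
    assert (Hsq : forall s, s * s = 1 -> cert N (fun x =>
              e + c * (nth i x 0 - nth i p 0) ^ 2 + s * (nth i x 0 - nth i p 0))).
    { intros s Hs.
      assert (Hq : polyfun N (fun x => 1 + s * (2 * c) * (nth i x 0 - nth i p 0))).
      { apply polyfun_add; [apply polyfun_const|]. apply polyfun_scal.
        apply polyfun_sub; [now apply polyfun_var|apply polyfun_const]. }
      eapply cert_ext; [apply (cert_scal N e _ ltac:(lra)
        (cert_sosfun N _ (sosfun_sq N _ Hq)))|].
      intros x. simpl. set (u := nth i x 0 - nth i p 0).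
      replace (e * ((1 + s * (2 * c) * u) * (1 + s * (2 * c) * u)))
        with (e + 4 * (c * e) * s * u + 4 * (c * e) * (s * s) * c * (u * u)) by ring.
      rewrite Hs, Hce. field. }
    split.
    + eapply cert_ext; [apply (cert_add N _ _ Hrest (Hsq 1 ltac:(lra)))|]. intros; simpl; ring.
    + eapply cert_ext; [apply (cert_add N _ _ Hrest (Hsq (-1) ltac:(lra)))|]. intros; simpl; ring.
  - destruct (IHf (e / 2)) as (c&Hc&H); [lra|]. destruct (IHg (e / 2)) as (c'&Hc'&H'); [lra|].
    exists (c + c'). split; [lra|]. intros p Hp.
    destruct (H p Hp) as [H1 H2]. destruct (H' p Hp) as [H1' H2']. split.
    + eapply cert_ext; [apply (cert_add N _ _ H1 H1')|]. intros; simpl; field.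
    + eapply cert_ext; [apply (cert_add N _ _ H2 H2')|]. intros; simpl; field.
  - destruct (cert_bounded N f Hf) as (bf&Hbf&_&_&Hfb).
    destruct (cert_bounded N g Hg) as (bg&Hbg&Hg1&Hg2&_).
    (* The increment of the product splits as [g(x) (f(x) - f(p)) + f(p) (g(x) - g(p))]. The two
       parts cost [bg h] and [bf h]; the spare [h] keeps the denominator positive. *)
    set (h := e / (bf + bg + 1)).
    assert (Hh : 0 < h) by (apply Rdiv_lt_0_compat; lra).
    assert (Heh : e = (bf + bg + 1) * h) by (unfold h; field; lra).
    destruct (IHf h Hh) as (c&Hc&H). destruct (IHg h Hh) as (c'&Hc'&H').
    exists (bg * c + bf * c'). split; [nra|]. intros p Hp.
    destruct (H p Hp) as [H1 H2]. destruct (H' p Hp) as [H1' H2'].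
    assert (Hfp : - bf <= f p <= bf) by (apply Rabs_le_inv; auto).
    destruct (cert_mul_abs N (fun _ => bg) g _ _ Hg1 Hg2 H1 H2) as [K1 K2].
    destruct (cert_mul_abs N (fun _ => bf) (fun _ => f p) _ _
      (cert_const N (bf + f p) ltac:(lra)) (cert_const N (bf - f p) ltac:(lra)) H1' H2') as [L1 L2].
    pose proof (cert_const N h ltac:(lra)) as Hch.
    split.
    + eapply cert_ext; [apply (cert_add N _ _ Hch (cert_add N _ _ K1 L1))|].
      intros; simpl. rewrite Heh. ring.
    + eapply cert_ext; [apply (cert_add N _ _ Hch (cert_add N _ _ K2 L2))|].
      intros; simpl. rewrite Heh. ring.
  - destruct (IH e He) as (c&Hc&H). exists c. split; [easy|]. intros p Hp.
    destruct (H p Hp) as [H1 H2]. split.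
    + eapply cert_ext; [exact H1|]. intros; simpl. now rewrite !Hfg.
    + eapply cert_ext; [exact H2|]. intros; simpl. now rewrite !Hfg.
Qed.

(* The law of [m] independent signs with mean [x_i]: a partition of unity by products of
   [(1 + x_i) / 2] and [(1 - x_i) / 2] whose variance is explicit. *)
Lemma sign_walk (N i m : nat) : (i < N)%nat ->
  exists W : list ((list R -> R) * R),
    (forall wq, In wq W -> cert N (fst wq) /\ Rabs (snd wq) <= INR m) /\
    forall x, rsum (map (fun wq => fst wq x) W) = 1 /\
      rsum (map (fun wq => fst wq x * (INR m * nth i x 0 - snd wq) ^ 2) W)
        = INR m * (1 - nth i x 0 ^ 2).
Proof.
  intros Hi. induction m as [|m [W [HW H]]].
  - exists [(fun _ => 1, 0)]. split.
    + intros wq [<-|[]]. simpl. rewrite Rabs_R0. split; [apply cert_const; lra|lra].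
    + intros x. simpl. split; ring.
  - set (st := fun (s : R) (wq : (list R -> R) * R) =>
                 ((fun x => fst wq x * (/2 * (1 + s * nth i x 0))), snd wq + s)).
    exists (map (st 1) W ++ map (st (-1)) W). split.
    + intros wq Hwq. rewrite S_INR. apply in_app_iff in Hwq.
      destruct Hwq as [Hwq|Hwq]; apply in_map_iff in Hwq; destruct Hwq as [w [<- Hw]];
        destruct (HW w Hw) as [H1 H2]; simpl; (split; [|apply Rabs_le; apply Rabs_le_inv in H2; lra]);
        apply cert_mul; try easy; (apply cert_scal; [lra|]).
      * apply (cert_one_plus_var N i 1); [lra|easy].
      * apply (cert_one_plus_var N i (-1)); [lra|easy].
    + intros x. destruct (H x) as [H1 H2]. rewrite !map_app, !rsum_app, !map_map.
      rewrite <- !rsum_map_plus. split.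
      * etransitivity; [|exact H1]. apply rsum_map_ext. intros w _. simpl. field.
      (* [(m + 1) x_i - (q + s) = (m x_i - q) + (x_i - s)]: averaged over the sign [s], the cross
         term vanishes and the last square has mean [1 - x_i^2]. *)
      * transitivity (rsum (map (fun w => fst w x * (INR m * nth i x 0 - snd w) ^ 2
            + (1 - nth i x 0 ^ 2) * fst w x) W)).
        -- apply rsum_map_ext. intros w _. unfold st. rewrite S_INR. cbn [fst snd]. field.
        -- rewrite rsum_map_plus, rsum_map_scal, H1, H2, S_INR. ring.
Qed.

(** The product law of [M] independent sign walks of length [D], rescaled by [1 / D] into the cube;
    each coordinate adds its own variance. The induction runs over [M] with [N] fixed, because the
    certificates refer to the sphere in all [N] variables. *)
Lemma bernstein_weights (N D M : nat) : (0 < D)%nat -> (M <= N)%nat ->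
  exists W : list ((list R -> R) * list R),
    (forall wp, In wp W -> cert N (fst wp) /\ box M 1 (snd wp)) /\
    forall x, rsum (map (fun wp => fst wp x) W) = 1 /\
      rsum (map (fun wp => fst wp x * sqdist M x (snd wp)) W)
        = bsum M (fun i => (1 - nth i x 0 ^ 2) / INR D).
Proof.
  intros HD. assert (HD' : 0 < INR D) by now apply lt_0_INR.
  induction M as [|M IH]; intros HM.
  - exists [(fun _ => 1, [])]. split.
    + intros wp [<-|[]]. split; [apply cert_const; lra|]. split; [easy|]. intros; lia.
    + intros x. unfold sqdist, bsum. simpl. split; ring.
  - destruct (IH ltac:(lia)) as [W [HW H]]. destruct (sign_walk N M D ltac:(lia)) as [V [HV H']].
    exists (map (fun ab => ((fun x => fst (fst ab) x * fst (snd ab) x),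
                            snd (fst ab) ++ [snd (snd ab) / INR D])) (list_prod W V)).
    split.
    + intros wp Hwp. apply in_map_iff in Hwp. destruct Hwp as [[w v] [<- Hin]].
      apply in_prod_iff in Hin. destruct Hin as [Hw Hv].
      destruct (HW w Hw) as [H1 [H2 H3]]. destruct (HV v Hv) as [H1' H2']. simpl.
      split; [now apply cert_mul|]. split; [rewrite length_app; simpl; lia|].
      intros j Hj. destruct (Nat.eq_dec j M) as [->|Hne].
      * rewrite app_nth2, H2, Nat.sub_diag by lia. simpl. unfold Rdiv. rewrite Rabs_mult, Rabs_inv.
        rewrite (Rabs_right (INR D)) by lra.
        apply Rmult_le_reg_r with (INR D); [easy|]. rewrite Rmult_assoc, Rinv_l; lra.
      * rewrite app_nth1 by lia. apply H3. lia.
    + intros x. destruct (H x) as [H1 H2]. destruct (H' x) as [H1' H2']. rewrite !map_map. split.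
      * etransitivity; [apply (rsum_list_prod (fun w v => fst w x * fst v x))|].
        rewrite <- H1. apply rsum_map_ext. intros w _. rewrite rsum_map_scal, H1'. ring.
      * cbn [fst snd]. rewrite bsum_S, <- H2.
        transitivity (rsum (map (fun ab => fst (fst ab) x * (fst (snd ab) x * sqdist M x (snd (fst ab))
           + / INR D ^ 2 * (fst (snd ab) x * (INR D * nth M x 0 - snd (snd ab)) ^ 2))) (list_prod W V))).
        { apply rsum_map_ext. intros [w v] Hin. apply in_prod_iff in Hin. destruct Hin as [Hw Hv].
          destruct (HW w Hw) as [_ [Hl _]]. cbn [fst snd]. unfold sqdist. rewrite bsum_S.
          rewrite app_nth2, Hl, Nat.sub_diag by lia. cbn [nth].
          rewrite (bsum_ext M (fun i => (nth i x 0 - nth i (snd w ++ [snd v / INR D]) 0) ^ 2)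
                     (fun i => (nth i x 0 - nth i (snd w) 0) ^ 2)).
          - field. lra.
          - intros j Hj. now rewrite app_nth1 by lia. }
        etransitivity; [apply (rsum_list_prod (fun w v => fst w x * (fst v x * sqdist M x (snd w)
           + / INR D ^ 2 * (fst v x * (INR D * nth M x 0 - snd v) ^ 2))))|].
        replace ((1 - nth M x 0 ^ 2) / INR D) with
          ((1 - nth M x 0 ^ 2) / INR D * rsum (map (fun wp => fst wp x) W)) by (rewrite H1; ring).
        rewrite <- rsum_map_scal, <- rsum_map_plus. apply rsum_map_ext. intros w _.
        rewrite rsum_map_scal, rsum_map_plus, rsum_map_scal, H2'.
        rewrite (rsum_map_ext (fun v => fst v x * sqdist M x (snd w))
                   (fun v => sqdist M x (snd w) * fst v x)) by (intros; ring).
        rewrite rsum_map_scal, H1'. field. lra.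
Qed.

Lemma nat_above (r : R) : exists n, (0 < n)%nat /\ r <= INR n.
Proof.
  destruct (INR_unbounded r) as [n Hn]. exists (S n). split; [lia|]. rewrite S_INR. lra.
Qed.

Theorem cert_of_positive (N : nat) (f : list R -> R) (e : R) : polyfun N f -> 0 < e ->
  (forall x, box N 1 x -> e <= f x) -> cert N f.
Proof.
  intros Hf He Hpos. destruct (cert_modulus N f Hf (e / 2)) as (c&Hc&Hmod); [lra|].
  destruct (nat_above (2 * c * INR N / e)) as (D&HD&HDc).
  assert (HD' : 0 < INR D) by now apply lt_0_INR.
  destruct (bernstein_weights N D N HD ltac:(lia)) as [W [HW H]].
  assert (H1 : cert N (fun x => rsum (map (fun wp =>
            fst wp x * (((e / 2 + c * sqdist N x (snd wp)) + (f x - f (snd wp)))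
              + (f (snd wp) - e))) W))).
  { apply (cert_rsum N (fun wp x => fst wp x * (((e / 2 + c * sqdist N x (snd wp))
              + (f x - f (snd wp))) + (f (snd wp) - e)))).
    intros wp Hwp. destruct (HW wp Hwp) as [Hw Hp]. apply cert_mul; [easy|].
    apply cert_add; [now apply Hmod|]. apply cert_const. specialize (Hpos _ Hp). lra. }
  (* The weighted sum above equals [f - e/2 + c V], where [V = (N - |x|^2) / D] is the variance. By
     the choice of [D], the missing [e/2 - c V] is a nonnegative constant plus a nonnegative
     multiple of [|x|^2]. *)
  assert (H2 : cert N (fun x => e / 2 - c * INR N / INR D + c / INR D * normsqr N x)).
  { apply cert_add.
    - apply cert_const. apply Rmult_le_reg_r with (INR D); [easy|].
      replace ((e / 2 - c * INR N / INR D) * INR D) with (e / 2 * INR D - c * INR N) by (field; lra).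
      assert (c * INR N = e / 2 * (2 * c * INR N / e)) as -> by (field; lra). nra.
    - apply cert_scal; [apply Rmult_le_pos; [easy|]; apply Rlt_le, Rinv_0_lt_compat; lra|].
      (* The coordinates of the empty list all default to 0, so [sqdist] to it is [|x|^2]. *)
      eapply cert_ext; [apply (cert_sqdist N [])|]. intros x. apply bsum_ext.
      intros i _. replace (nth i (@nil R) 0) with 0 by (now destruct i). f_equal. lra. }
  eapply cert_ext; [apply (cert_add N _ _ H1 H2)|]. intros x. cbn beta.
  destruct (H x) as [K1 K2].
  rewrite (rsum_map_ext _ (fun wp => (f x - e / 2) * fst wp x
     + c * (fst wp x * sqdist N x (snd wp)))) by (intros; field).
  rewrite rsum_map_plus, !rsum_map_scal, K1, K2.
  rewrite (bsum_ext N _ (fun i => / INR D + - / INR D * nth i x 0 ^ 2)) by (intros; field; lra).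
  rewrite bsum_plus, bsum_const, bsum_scal. unfold normsqr. field. lra.
Qed.

(** * Putinar's Positivstellensatz on the sphere *)

(** For [0 < t <= 1] and [m = 2k], Bernoulli gives [(1 + m t) (1 - t)^m <= (1 - t^2)^m <= 1]; for
    [t <= 0] the left side is not positive. The even exponent makes the multiplier of each
    constraint a square later. *)
Lemma bump_le (t : R) (k : nat) : (0 < k)%nat -> t <= 1 -> t * (1 - t) ^ (2 * k) <= / INR k.
Proof.
  intros Hk Ht. assert (HI : 0 < INR k) by now apply lt_0_INR.
  pose proof (Rinv_0_lt_compat _ HI).
  assert (Hp : 0 <= (1 - t) ^ (2 * k)) by (apply pow_le; lra).
  destruct (Rle_dec t 0); [nra|].
  set (m := (2 * k)%nat) in *.
  assert (Hb : 1 + INR m * t <= (1 + t) ^ m) by (apply poly; lra).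
  assert (Hprod : (1 + t) ^ m * (1 - t) ^ m <= 1).
  { rewrite <- Rpow_mult_distr. apply Rle_trans with (1 ^ m); [apply pow_incr; nra|rewrite pow1; lra]. }
  assert (Hm : INR k <= INR m) by (apply le_INR; lia).
  apply Rmult_le_reg_l with (INR k); [easy|]. rewrite Rinv_r by lra.
  assert (INR k * (t * (1 - t) ^ m) <= INR m * t * (1 - t) ^ m).
  { rewrite <- Rmult_assoc. apply Rmult_le_compat_r; [easy|]. apply Rmult_le_compat_r; lra. }
  assert ((1 + INR m * t) * (1 - t) ^ m <= (1 + t) ^ m * (1 - t) ^ m)
    by now apply Rmult_le_compat_r.
  lra.
Qed.

Lemma rsum_le_some {A : Type} (f : A -> R) (l : list A) (th d : R) (a : A) : 0 <= th ->
  (forall b, In b l -> f b <= th) -> In a l -> f a <= - d ->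
  rsum (map f l) <= - d + INR (length l) * th.
Proof.
  intros Hth H Ha Hd. induction l as [|b l IH]; [easy|].
  cbn [map length]. change (rsum (f b :: map f l)) with (f b + rsum (map f l)). rewrite S_INR.
  destruct Ha as [->|Ha].
  - assert (rsum (map f l) <= INR (length l) * th); [|lra].
    rewrite <- rsum_map_const. apply rsum_map_le. auto with datatypes.
  - assert (rsum (map f l) <= - d + INR (length l) * th) by (apply IH; auto with datatypes).
    assert (f b <= th) by auto with datatypes. lra.
Qed.

(* Subtracting [c h (1 - h)^(2k)] costs little where [h >= 0] and gains [c e] where [h <= -e]. *)
Lemma positive_on_cube (N : nat) (f : list R -> R) (H : list (list R -> R)) (e : R) :
  polyfun N f -> 0 < e ->
  (forall h x, In h H -> box N 1 x -> h x <= 1) ->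
  (forall x, box N 1 x -> e <= f x \/ exists h, In h H /\ h x <= - e) ->
  exists c k, 0 <= c /\ forall x, box N 1 x ->
    e / 2 <= f x - c * rsum (map (fun h => h x * (1 - h x) ^ (2 * k)) H).
Proof.
  intros Hf He Hle Hdich. destruct (cert_bounded N f Hf) as (b&Hb&_&_&Hfb).
  (* [c e = b + e] outweighs the worst value [-b] of [f] where some constraint is at most [-e]; [k]
     is then taken so large that the total loss [c |H| / k] is at most [e / 2]. *)
  set (c := (b + e) / e). assert (Hc : 0 <= c) by (apply Rlt_le, Rdiv_lt_0_compat; lra).
  assert (Hce : c * e = b + e) by (unfold c; field; lra).
  destruct (nat_above (2 * c * INR (length H) / e)) as (k&Hk&HkI).
  assert (HI : 0 < INR k) by now apply lt_0_INR.
  pose proof (Rinv_0_lt_compat _ HI) as Hinv.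
  assert (Hth : c * (INR (length H) * / INR k) <= e / 2).
  { apply Rmult_le_reg_r with (INR k); [easy|].
    replace (c * (INR (length H) * / INR k) * INR k) with (c * INR (length H)) by (field; lra).
    assert (c * INR (length H) = e / 2 * (2 * c * INR (length H) / e)) as -> by (field; lra). nra. }
  exists c, k. split; [easy|]. intros x Hx.
  assert (Hbump : forall h, In h H -> h x * (1 - h x) ^ (2 * k) <= / INR k)
    by (intros h Hh; apply bump_le; auto).
  destruct (Hdich x Hx) as [Hfx|[h [Hh Hhx]]].
  - assert (rsum (map (fun h => h x * (1 - h x) ^ (2 * k)) H) <= INR (length H) * / INR k).
    { rewrite <- rsum_map_const. apply rsum_map_le. exact Hbump. }
    nra.
  - assert (Hs : rsum (map (fun h => h x * (1 - h x) ^ (2 * k)) H)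
            <= - e + INR (length H) * / INR k).
    { apply (rsum_le_some _ _ _ _ h); [lra|exact Hbump|exact Hh|].
      assert (1 <= (1 - h x) ^ (2 * k)) by (apply pow_R1_Rle; lra). nra. }
    destruct (Rabs_le_inv _ _ (Hfb x Hx)). nra.
Qed.

(** Compactness applied to a local dichotomy: either some [h] is negative at the point and stays so
    nearby, or all are nonnegative there and [f] stays positive nearby. A union takes the smaller
    gap. *)
Lemma positivity_gap (N : nat) (f : list R -> R) (H : list (list R -> R)) :
  polyfun N f -> (forall h, In h H -> polyfun N h) ->
  (forall x, box N 1 x -> (forall h, In h H -> 0 <= h x) -> 0 < f x) ->
  exists e, 0 < e /\ forall x, box N 1 x -> e <= f x \/ exists h, In h H /\ h x <= - e.
Proof.
  intros Hf HH Hpos.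
  apply (box_induction N 1 (fun U => exists e, 0 < e /\ forall x, U x ->
           e <= f x \/ exists h, In h H /\ h x <= - e)); [lra| | |].
  - intros U V HUV (e&He&Hd). exists e. auto.
  - intros U V (e&He&Hd) (e'&He'&Hd'). exists (Rmin e e').
    pose proof (Rmin_l e e'); pose proof (Rmin_r e e'). split; [now apply Rmin_glb_lt|].
    intros x [Hx|Hx]; [destruct (Hd x Hx) as [?|(h&?&?)]|destruct (Hd' x Hx) as [?|(h&?&?)]];
      solve [left; lra|right; exists h; split; [easy|lra]].
  - intros x Hx. destruct (classic (exists h, In h H /\ h x < 0)) as [(h&Hh&Hhx)|Hn].
    + destruct (polyfun_continuous N h (HH h Hh) x (- h x / 2)) as (d&Hd&Hc); [lra|].
      exists d. split; [easy|]. exists (- h x / 2). split; [lra|]. intros y [_ Hy]. right.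
      exists h. split; [easy|]. apply Hc in Hy. apply Rabs_def2 in Hy. lra.
    + assert (Hfx : 0 < f x).
      { apply Hpos; [easy|]. intros h Hh. apply Rnot_lt_le. intros Hlt. apply Hn. now exists h. }
      destruct (polyfun_continuous N f Hf x (f x / 2)) as (d&Hd&Hc); [lra|].
      exists d. split; [easy|]. exists (f x / 2). split; [lra|]. intros y [_ Hy]. left.
      apply Hc in Hy. apply Rabs_def2 in Hy. lra.
Qed.

Lemma common_bound (N : nat) (H : list (list R -> R)) : (forall h, In h H -> polyfun N h) ->
  exists b, 1 <= b /\ forall h x, In h H -> box N 1 x -> h x <= b.
Proof.
  induction H as [|h H IH]; intros HH; [exists 1; split; [lra|easy]|].
  destruct IH as (b&Hb&IHb); [auto with datatypes|].
  destruct (cert_bounded N h) as (b'&Hb'&_&_&Hh); [auto with datatypes|].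
  exists (b + b'). split; [lra|]. intros h' x [<-|Hin] Hx.
  - specialize (Hh x Hx). apply Rabs_le_inv in Hh. lra.
  - specialize (IHb h' x Hin Hx). lra.
Qed.

Theorem putinar_sphere (N : nat) (f : list R -> R) (H : list (list R -> R)) :
  polyfun N f -> (forall h, In h H -> polyfun N h) ->
  (forall x, length x = N -> normsqr N x = 1 -> (forall h, In h H -> 0 <= h x) -> 0 < f x) ->
  exists (s r : list R -> R) (m : (list R -> R) -> list R -> R),
    sosfun N s /\ polyfun N r /\ (forall h, In h H -> sosfun N (m h)) /\
    forall x, f x = s x + rsum (map (fun h => m h x * h x) H) + r x * (normsqr N x - 1).
Proof.
  intros Hf HH Hpos. destruct (common_bound N H HH) as (b&Hb&Hbound).
  assert (Hib : 0 < / b) by (apply Rinv_0_lt_compat; lra).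
  set (E := fun x => normsqr N x - 1).
  assert (PE : polyfun N E) by (apply polyfun_sub; [apply polyfun_normsqr|apply polyfun_const]).
  set (sc := fun (h : list R -> R) x => / b * h x).
  set (sph := fun x => - (E x * E x)).
  set (H' := sph :: map sc H).
  assert (PH' : forall h, In h H' -> polyfun N h).
  { intros h [<-|Hh].
    - eapply polyfun_ext; [apply (polyfun_scal N (-1) _ (polyfun_mul N _ _ PE PE))|].
      intros x; unfold sph; simpl; ring.
    - apply in_map_iff in Hh. destruct Hh as [g [<- Hg]]. apply polyfun_scal. auto. }
  destruct (positivity_gap N f H' Hf PH') as (e&He&Hdich).
  { intros x [Hl Hx] Hall. apply Hpos; [easy| |].
    - assert (0 <= sph x) by (apply Hall; now left). unfold sph in *.
      assert (E x = 0) by nra. unfold E in *. lra.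
    - intros h Hh. assert (0 <= sc h x) by (apply Hall; right; now apply in_map).
      unfold sc in *. nra. }
  destruct (positive_on_cube N f H' e Hf He) as (c&k&Hc&Hbig); [|easy|].
  { intros h x [<-|Hh] Hx.
    - unfold sph. nra.
    - apply in_map_iff in Hh. destruct Hh as [g [<- Hg]]. unfold sc.
      specialize (Hbound g x Hg Hx). apply Rmult_le_reg_l with b; [lra|].
      rewrite <- Rmult_assoc, Rinv_r by lra. lra. }
  assert (Hcert : cert N (fun x => f x - c * rsum (map (fun h => h x * (1 - h x) ^ (2 * k)) H'))).
  { apply (cert_of_positive N _ (e / 2)); [|lra|easy].
    apply polyfun_sub; [easy|]. apply polyfun_scal.
    apply (polyfun_rsum N (fun h x => h x * (1 - h x) ^ (2 * k))). intros h Hh.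
    apply polyfun_mul; [auto|]. apply polyfun_pow, polyfun_sub; [apply polyfun_const|auto]. }
  destruct Hcert as (s&r&Hs&Hr&Heq).
  (* Since [sph = -E^2], its term [c sph (1 - sph)^(2k)] is [E] times a polynomial and is absorbed
     into [r]. The other multipliers are nonnegative constants times squares. *)
  exists s, (fun x => r x - c * (E x * (1 - sph x) ^ (2 * k))),
    (fun h x => c * / b * (1 - sc h x) ^ (2 * k)).
  split; [easy|]. split; [|split].
  - apply polyfun_sub; [easy|]. apply polyfun_scal, polyfun_mul; [easy|].
    apply polyfun_pow, polyfun_sub; [apply polyfun_const|]. apply PH'. now left.
  - intros h Hh. apply sosfun_mul; [apply sosfun_const; nra|].
    eapply sosfun_ext; [apply (sosfun_sq N (fun x => (1 - sc h x) ^ k))|].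
    + apply polyfun_pow, polyfun_sub; [apply polyfun_const|]. apply polyfun_scal; auto.
    + intros x. cbn beta. rewrite <- pow_add. f_equal. lia.
  - intros x. specialize (Heq x). unfold H' in Heq. cbn [map] in Heq.
    change (rsum (?a :: ?l)) with (a + rsum l) in Heq. rewrite map_map in Heq.
    rewrite (rsum_map_ext (fun h => c * / b * (1 - sc h x) ^ (2 * k) * h x)
               (fun h => c * (sc h x * (1 - sc h x) ^ (2 * k)))) by (intros; unfold sc; ring).
    rewrite rsum_map_scal. fold (E x) in Heq. fold (E x).
    unfold sph in *. set (q := (1 - - (E x * E x)) ^ (2 * k)) in *. clearbody q.
    set (t := rsum _) in *. clearbody t. nra.
Qed.

(** * Closed convex cones *)

Lemma nth_map0 (i : nat) (f : R -> R) (x : list R) : f 0 = 0 ->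
  nth i (map f x) 0 = f (nth i x 0).
Proof. intros Hf. rewrite <- (map_nth f x 0 i). now rewrite Hf. Qed.

Lemma nth_scale (i : nat) (c : R) (x : list R) : nth i (map (Rmult c) x) 0 = c * nth i x 0.
Proof. apply (nth_map0 i (Rmult c)). ring. Qed.

Lemma dot_scale (N : nat) (c : R) (a x : list R) : dot N a (map (Rmult c) x) = c * dot N a x.
Proof.
  unfold dot. rewrite <- bsum_scal. apply bsum_ext. intros i _. rewrite nth_scale. ring.
Qed.

Lemma dot_rsum {A : Type} (N : nat) (a x : list R) (w : A -> R) (p : A -> list R) (l : list A) :
  (forall i, (i < N)%nat -> nth i x 0 = rsum (map (fun b => w b * nth i (p b) 0) l)) ->
  dot N a x = rsum (map (fun b => w b * dot N a (p b)) l).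
Proof.
  intros Hx. unfold dot.
  rewrite (bsum_ext N _ (fun i => rsum (map (fun b => nth i a 0 * (w b * nth i (p b) 0)) l))).
  - rewrite bsum_rsum. apply rsum_map_ext. intros b _. rewrite <- bsum_scal.
    apply bsum_ext. intros; ring.
  - intros i Hi. now rewrite rsum_map_scal, Hx.
Qed.

Lemma closure_close (N : nat) (A : list R -> Prop) (x : list R) : closure N A x <->
  length x = N /\ forall d, 0 < d -> exists y, A y /\ length y = N /\ close N d x y.
Proof.
  split; intros [Hl H]; (split; [exact Hl|]); intros d Hd.
  - destruct (H d Hd) as (y&Hy&Hly&Hxy). exists y. repeat split; auto. now apply close_of_dist.
  - destruct (H (d / INR (S N))) as (y&Hy&Hly&Hxy).
    { apply Rdiv_lt_0_compat; [easy|]. apply lt_0_INR; lia. }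
    exists y. repeat split; auto. now apply dist_of_close.
Qed.

Lemma closed_complement (N : nat) (K : list R -> Prop) (x : list R) :
  is_closed N K -> length x = N -> ~ K x ->
  exists d, 0 < d /\ forall y, K y -> length y = N -> ~ close N d x y.
Proof.
  intros Hcl Hl Hx. apply NNPP. intros Hn. apply Hx, Hcl, closure_close. split; [easy|].
  intros d Hd. apply NNPP. intros Hn'. apply Hn. exists d. split; [easy|].
  intros y Hy Hly Hxy. apply Hn'. now exists y.
Qed.

Record convex_cone (N : nat) (K : list R -> Prop) : Prop := {
  cone_length : forall x, K x -> length x = N;
  cone_add : forall x y, K x -> K y -> K (vec N (fun i => nth i x 0 + nth i y 0));
  cone_scale : forall t x, 0 <= t -> K x -> K (map (Rmult t) x);
  cone_zero : K (vec N (fun _ => 0))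
}.

Lemma sqdist_polyfun (N : nat) (p : list R) : polyfun N (fun x => sqdist N x p).
Proof.
  apply (polyfun_bsum N N (fun i x => (nth i x 0 - nth i p 0) ^ 2)). intros i Hi.
  apply polyfun_pow, polyfun_sub; [now apply polyfun_var|apply polyfun_const].
Qed.

Lemma sqdist_nonneg (N : nat) (x p : list R) : 0 <= sqdist N x p.
Proof. apply bsum_nonneg. intros; apply pow2_ge_0. Qed.

(** If the infimum [m] were not attained, every point would have a neighbourhood where [K] keeps
    squared distance above a constant exceeding [m]; compactness of a large box makes that constant
    uniform, against the infimum. *)
Lemma nearest_point (N : nat) (K : list R -> Prop) (p : list R) :
  (forall x, K x -> length x = N) -> is_closed N K -> (exists z, K z) ->
  exists z, K z /\ forall y, K y -> sqdist N z p <= sqdist N y p.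
Proof.
  intros Hlen Hcl [z0 Hz0].
  destruct (completeness (fun r => exists y, K y /\ r = - sqdist N y p)) as [m' [Hub Hlub]].
  { exists 0. intros r (y&_&->). pose proof (sqdist_nonneg N y p). lra. }
  { now exists (- sqdist N z0 p), z0. }
  set (m := - m').
  assert (Hm : forall y, K y -> m <= sqdist N y p).
  { intros y Hy. assert (- sqdist N y p <= m') by (apply Hub; now exists y). unfold m; lra. }
  assert (Hm0 : 0 <= m).
  { assert (m' <= 0); [|unfold m; lra]. apply Hlub. intros r (y&_&->).
    pose proof (sqdist_nonneg N y p). lra. }
  apply NNPP. intros Hn.
  assert (Hgt : forall y, K y -> m < sqdist N y p).
  { intros y Hy. apply Rnot_le_lt. intros Hle. apply Hn. exists y. split; [easy|].
    intros y' Hy'. specialize (Hm y' Hy'). lra. }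
  assert (Hinf : forall c, m < c -> ~ forall y, K y -> c <= sqdist N y p).
  { intros c Hc Hall. assert (m' <= - c); [|unfold m in *; lra]. apply Hlub.
    intros r (y&Hy&->). specialize (Hall y Hy). lra. }
  (* Outside the box of radius [B + m + 1] some coordinate differs from that of [p] by more than
     [m + 1], so the squared distance exceeds [(m + 1)^2 >= m + 1]. *)
  set (B := bsum N (fun i => Rabs (nth i p 0))).
  assert (HB : forall i, (i < N)%nat -> Rabs (nth i p 0) <= B).
  { intros i Hi. apply (bsum_ge_term N i (fun i => Rabs (nth i p 0))); [|easy].
    intros; apply Rabs_pos. }
  assert (HB0 : 0 <= B) by (apply bsum_nonneg; intros; apply Rabs_pos).
  assert (exists c, m < c /\ forall y, box N (B + m + 1) y -> K y -> c <= sqdist N y p) as (c&Hc&Hbox).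
  { apply (box_induction N (B + m + 1)
      (fun U => exists c, m < c /\ forall y, U y -> K y -> c <= sqdist N y p)); [lra| | |].
    - intros U V HUV (c&Hc&H). exists c. auto.
    - intros U V (c&Hc&H) (c'&Hc'&H'). exists (Rmin c c').
      pose proof (Rmin_l c c'); pose proof (Rmin_r c c'). split; [now apply Rmin_glb_lt|].
      intros y [Hy|Hy] HK; [specialize (H y Hy HK)|specialize (H' y Hy HK)]; lra.
    - intros x [Hl Hx]. destruct (classic (K x)) as [HK|HK].
      + specialize (Hgt x HK). set (e := (sqdist N x p - m) / 2).
        destruct (polyfun_continuous N _ (sqdist_polyfun N p) x e) as (d&Hd&Hcont);
          [unfold e; lra|].
        exists d. split; [easy|]. exists (m + e). split; [unfold e; lra|].
        intros y [_ Hy] _. apply Hcont, Rabs_def2 in Hy. unfold e in *. lra.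
      + destruct (closed_complement N K x Hcl Hl HK) as (d&Hd&Hfar).
        exists d. split; [easy|]. exists (m + 1). split; [lra|].
        intros y [Hly Hy] HKy. now destruct (Hfar y). }
  apply (Hinf (Rmin c (m + 1))); [apply Rmin_glb_lt; lra|]. intros y Hy.
  destruct (classic (box N (B + m + 1) y)) as [Hin|Hout].
  - eapply Rle_trans; [apply Rmin_l|auto].
  - eapply Rle_trans; [apply Rmin_r|].
    assert (exists i, (i < N)%nat /\ B + m + 1 < Rabs (nth i y 0)) as (i&Hi&Hyi).
    { apply NNPP. intros Hno. apply Hout. split; [auto|]. intros i Hi. apply Rnot_lt_le.
      intros Hlt. apply Hno. now exists i. }
    apply Rle_trans with ((nth i y 0 - nth i p 0) ^ 2).
    + specialize (HB i Hi). pose proof (Rabs_triang_inv (nth i y 0) (nth i p 0)).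
      rewrite <- (pow2_abs (_ - _)). nra.
    + apply (bsum_ge_term N i (fun i => (nth i y 0 - nth i p 0) ^ 2)); [|easy].
      intros; apply pow2_ge_0.
Qed.

(** The first-order condition at a minimum: for small [t] the linear term dominates. *)
Lemma quadratic_nonneg (u v : R) : (forall t, 0 < t <= 1 -> 0 <= 2 * t * u + t ^ 2 * v) -> 0 <= u.
Proof.
  intros H. apply Rnot_lt_le. intros Hu.
  set (t := Rmin 1 (- u / (Rabs v + 1))). pose proof (Rabs_pos v). pose proof (Rle_abs v).
  assert (Ht : 0 < t) by (apply Rmin_glb_lt; [lra|apply Rdiv_lt_0_compat; lra]).
  assert (Htu : t * (Rabs v + 1) <= - u).
  { apply Rle_trans with (- u / (Rabs v + 1) * (Rabs v + 1)); [|right; field; lra].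
    apply Rmult_le_compat_r; [lra|apply Rmin_r]. }
  specialize (H t (conj Ht (Rmin_l _ _))).
  assert (0 <= t * (2 * u + t * v)) by lra.
  assert (t * v <= t * (Rabs v + 1)) by nra. nra.
Qed.

(** Take [a = z - p] with [z] the point of [K] nearest to [p]. Moving from [z] to [z + t w] gives
    [a . w >= 0], shrinking to [(1 - t) z] gives [a . z <= 0], and [a . p = a . z - |z - p|^2]. *)
Lemma cone_separation (N : nat) (K : list R -> Prop) (p : list R) :
  convex_cone N K -> is_closed N K -> length p = N -> ~ K p ->
  exists a, length a = N /\ (forall y, K y -> 0 <= dot N a y) /\ dot N a p < 0.
Proof.
  intros HK Hcl Hlp Hp.
  destruct (nearest_point N K p (cone_length N K HK) Hcl) as (z&Hz&Hmin).
  { eexists. apply (cone_zero N K HK). }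
  set (a := vec N (fun i => nth i z 0 - nth i p 0)).
  assert (Ha : forall i, (i < N)%nat -> nth i a 0 = nth i z 0 - nth i p 0)
    by (intros; now apply nth_vec).
  assert (Hpert : forall y w t, (forall i, (i < N)%nat -> nth i y 0 = nth i z 0 + t * nth i w 0) ->
            sqdist N y p = sqdist N z p + (2 * t * dot N a w + t ^ 2 * normsqr N w)).
  { intros y w t Hy. unfold sqdist, dot, normsqr. rewrite <- !bsum_scal, <- !bsum_plus.
    apply bsum_ext. intros i Hi. rewrite Hy, Ha by easy. ring. }
  assert (Hpos : forall w, K w -> 0 <= dot N a w).
  { intros w Hw. apply (quadratic_nonneg _ (normsqr N w)). intros t Ht.
    set (y := vec N (fun i => nth i z 0 + nth i (map (Rmult t) w) 0)).
    assert (Hy : K y) by (apply (cone_add N K HK); [easy|]; apply (cone_scale N K HK); [lra|easy]).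
    specialize (Hmin y Hy). rewrite (Hpert y w t) in Hmin; [lra|].
    intros i Hi. unfold y. now rewrite nth_vec, nth_scale. }
  assert (Hz0 : 0 <= - dot N a z).
  { apply (quadratic_nonneg _ (normsqr N z)). intros t Ht.
    assert (Hy : K (map (Rmult (1 - t)) z)) by (apply (cone_scale N K HK); [lra|easy]).
    specialize (Hmin _ Hy). rewrite (Hpert (map (Rmult (1 - t)) z) z (- t)) in Hmin.
    { replace ((- t) ^ 2) with (t ^ 2) in Hmin by ring. lra. }
    intros i Hi. rewrite nth_scale. ring. }
  exists a. split; [apply length_vec|]. split; [easy|].
  assert (Hap : dot N a p = dot N a z - sqdist N z p).
  { assert (dot N a p + sqdist N z p = dot N a z); [|lra].
    unfold dot, sqdist. rewrite <- bsum_plus. apply bsum_ext. intros i Hi. rewrite Ha by easy. ring. }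
  destruct (Rle_lt_or_eq_dec 0 _ (sqdist_nonneg N z p)) as [Hlt|Heq]; [lra|].
  exfalso. apply Hp. replace p with z; [easy|].
  apply (vector_ext N); [now apply (cone_length N K HK)|easy|]. intros i Hi.
  assert ((nth i z 0 - nth i p 0) ^ 2 <= 0).
  { eapply Rle_trans; [|right; symmetry; exact Heq].
    apply (bsum_ge_term N i (fun i => (nth i z 0 - nth i p 0) ^ 2)); [|easy].
    intros; apply pow2_ge_0. }
  nra.
Qed.

Lemma dot_vec_plus (N : nat) (a b x : list R) (c : R) :
  dot N (vec N (fun i => nth i a 0 + c * nth i b 0)) x = dot N a x + c * dot N b x.
Proof.
  unfold dot. rewrite <- bsum_scal, <- bsum_plus. apply bsum_ext. intros i Hi.
  rewrite nth_vec by easy. ring.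
Qed.

(** For a unit vector [x] of [K], pointedness puts [-x] outside [K], and a functional separating it
    is nonnegative on [K] and positive near [x]. By compactness a finite sum of such functionals is
    positive on all unit vectors of [K]. *)
Lemma pointed_cone_strict (N : nat) (K : list R -> Prop) :
  convex_cone N K -> is_closed N K -> pointed N K ->
  exists b, length b = N /\ forall y, K y -> normsqr N y = 1 -> 0 < dot N b y.
Proof.
  intros HK Hcl Hpt.
  (* Nonnegativity on all of [K] belongs to the property so that the sum of two functionals stays
     positive wherever one of them is. *)
  assert (exists b, length b = N /\ (forall y, K y -> 0 <= dot N b y) /\
            forall y, box N 1 y -> K y -> normsqr N y = 1 -> 0 < dot N b y) as (b&Hlb&_&Hb).
  { assert (Hz : forall y, 0 <= dot N (vec N (fun _ => 0)) y).
    { intros y. apply bsum_nonneg. intros i Hi. rewrite nth_vec by easy. lra. }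
    apply (box_induction N 1 (fun U => exists b, length b = N /\ (forall y, K y -> 0 <= dot N b y) /\
            forall y, U y -> K y -> normsqr N y = 1 -> 0 < dot N b y)); [lra| | |].
    - intros U V HUV (b&Hl&H1&H2). exists b. auto.
    - intros U V (b&Hl&H1&H2) (b'&Hl'&H1'&H2').
      exists (vec N (fun i => nth i b 0 + 1 * nth i b' 0)).
      split; [apply length_vec|]. split; intros y; rewrite dot_vec_plus.
      + intros Hy. specialize (H1 y Hy). specialize (H1' y Hy). lra.
      + intros HUV Hy Hn. specialize (H1 y Hy). specialize (H1' y Hy).
        destruct HUV as [Hu|Hv]; [specialize (H2 y Hu Hy Hn)|specialize (H2' y Hv Hy Hn)]; lra.
    - intros x [Hl Hx]. destruct (classic (K x)) as [HKx|HKx].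
      + destruct (Req_dec (normsqr N x) 1) as [Hn|Hn].
        * destruct (cone_separation N K (map Ropp x) HK Hcl) as (b&Hlb&H1&H2).
          { now rewrite length_map. }
          { intros Hneg. pose proof (Hpt x HKx Hneg) as H0.
            assert (normsqr N x = 0); [|lra]. unfold normsqr.
            rewrite (bsum_ext N _ (fun _ => 0)); [rewrite bsum_const; ring|].
            intros i Hi. rewrite H0 by easy. ring. }
          assert (Hbx : 0 < dot N b x).
          { replace (map Ropp x) with (map (Rmult (-1)) x) in H2
              by (apply map_ext; intros; ring).
            rewrite dot_scale in H2. lra. }
          destruct (polyfun_continuous N _ (polyfun_dot N b) x _ Hbx) as (d&Hd&Hc).
          exists d. split; [easy|]. exists b. repeat split; [easy|easy|].
          intros y [_ Hy] _ _. apply Hc, Rabs_def2 in Hy. lra.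
        * destruct (polyfun_continuous N _ (polyfun_normsqr N) x (Rabs (normsqr N x - 1)))
            as (d&Hd&Hc); [apply Rabs_pos_lt; lra|].
          exists d. split; [easy|]. exists (vec N (fun _ => 0)). repeat split; [apply length_vec|auto|].
          intros y [_ Hy] _ Hny. apply Hc in Hy. rewrite Hny in Hy. lra.
      + destruct (closed_complement N K x Hcl Hl HKx) as (d&Hd&Hfar).
        exists d. split; [easy|]. exists (vec N (fun _ => 0)). repeat split; [apply length_vec|auto|].
        intros y [Hly Hy] HKy. now destruct (Hfar y). }
  exists b. split; [easy|]. intros y Hy Hn. apply Hb; auto. split; [now apply (cone_length N K HK)|].
  intros i Hi. assert (nth i y 0 ^ 2 <= 1).
  { rewrite <- Hn. apply (bsum_ge_term N i (fun i => nth i y 0 ^ 2)); [|easy].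
    intros; apply pow2_ge_0. }
  apply Rabs_le. nra.
Qed.

Lemma strict_separation (N : nat) (K : list R -> Prop) (p : list R) :
  convex_cone N K -> is_closed N K -> pointed N K -> length p = N -> ~ K p ->
  exists a, length a = N /\ (forall y, K y -> normsqr N y = 1 -> 0 < dot N a y) /\ dot N a p < 0.
Proof.
  intros HK Hcl Hpt Hl Hp.
  destruct (cone_separation N K p HK Hcl Hl Hp) as (a&Hla&Ha&Hap).
  destruct (pointed_cone_strict N K HK Hcl Hpt) as (b&Hlb&Hb).
  pose proof (Rabs_pos (dot N b p)). pose proof (Rle_abs (dot N b p)).
  (* A small multiple of [b] makes [a] strict on [K]; [c |b . p|] is at most half of [-(a . p)], so
     the value at [p] stays negative. *)
  set (c := - dot N a p / (2 * (Rabs (dot N b p) + 1))).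
  assert (Hc : 0 < c) by (apply Rdiv_lt_0_compat; lra).
  assert (Hc' : c * (2 * (Rabs (dot N b p) + 1)) = - dot N a p) by (unfold c; field; lra).
  exists (vec N (fun i => nth i a 0 + c * nth i b 0)). split; [apply length_vec|].
  rewrite dot_vec_plus. split.
  - intros y Hy Hn. rewrite dot_vec_plus. specialize (Ha y Hy). specialize (Hb y Hy Hn). nra.
  - nra.
Qed.

Lemma closure_scale (N : nat) (A : list R -> Prop) (t : R) (x : list R) : 0 < t ->
  (forall y, A y -> A (map (Rmult t) y)) -> closure N A x -> closure N A (map (Rmult t) x).
Proof.
  intros Ht HA Hx. apply closure_close in Hx. apply closure_close. destruct Hx as [Hl Hx].
  split; [now rewrite length_map|]. intros d Hd.
  destruct (Hx (d / t)) as (y&Hy&Hly&Hxy); [now apply Rdiv_lt_0_compat|].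
  exists (map (Rmult t) y). repeat split; [auto|now rewrite length_map|].
  intros i Hi. rewrite !nth_scale, <- Rmult_minus_distr_l, Rabs_mult, (Rabs_right t) by lra.
  specialize (Hxy i Hi). apply Rmult_lt_compat_l with (r := t) in Hxy; [|easy].
  replace (t * (d / t)) with d in Hxy by (field; lra). easy.
Qed.

Lemma conv_intro (N : nat) (A : list R -> Prop) (x : list R) :
  A x -> length x = N -> conv N A x.
Proof.
  intros HA Hl. split; [easy|]. exists [(1, x)]. repeat split.
  - repeat constructor; simpl; auto; lra.
  - simpl; lra.
  - intros i _. simpl. ring.
Qed.

Lemma conv_cone (N : nat) (A : list R -> Prop) :
  (forall t y, 0 < t -> A y -> A (map (Rmult t) y)) ->
  A (vec N (fun _ => 0)) -> convex_cone N (conv N A).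
Proof.
  intros HA Hzero.
  assert (Hz : conv N A (vec N (fun _ => 0))) by (apply conv_intro; [easy|apply length_vec]).
  split; [now intros x [Hl _]| | |easy].
  - intros x y (Hlx&ps&Hps&Hs&Hx) (Hly&qs&Hqs&Hs'&Hy). split; [apply length_vec|].
    (* Halving weights and doubling points turns the concatenation of two convex combinations into
       one that represents the sum [x + y]. *)
    set (dbl := fun wp : R * list R => (/ 2 * fst wp, map (Rmult 2) (snd wp))).
    exists (map dbl ps ++ map dbl qs).
    assert (Hd : forall l, Forall (fun wp => 0 <= fst wp /\ A (snd wp) /\ length (snd wp) = N) l ->
              Forall (fun wp => 0 <= fst wp /\ A (snd wp) /\ length (snd wp) = N) (map dbl l)).
    { intros l Hl. apply Forall_map. eapply Forall_impl; [|exact Hl]. intros wp (H1&H2&H3). simpl.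
      rewrite length_map. repeat split; [lra| |easy]. apply HA; [lra|easy]. }
    split; [apply Forall_app; auto|]. split.
    + rewrite map_app, rsum_app, !map_map. unfold dbl; cbn [fst]. rewrite !rsum_map_scal, Hs, Hs'. lra.
    + intros i Hi. rewrite nth_vec, Hx, Hy by easy. rewrite map_app, rsum_app, !map_map.
      f_equal; apply rsum_map_ext; intros wp _; unfold dbl; cbn [fst snd]; rewrite nth_scale; field.
  - intros t x Ht Hx. destruct (Req_dec t 0) as [->|Hne].
    + replace (map (Rmult 0) x) with (vec N (fun _ : nat => 0)); [easy|].
      destruct Hx as [Hl _]. apply (vector_ext N); [apply length_vec|now rewrite length_map|].
      intros i Hi. rewrite nth_vec, nth_scale by easy. ring.
    + destruct Hx as (Hl&ps&Hps&Hs&Hx). split; [now rewrite length_map|].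
      exists (map (fun wp => (fst wp, map (Rmult t) (snd wp))) ps). repeat split.
      * apply Forall_map. eapply Forall_impl; [|exact Hps]. intros wp (H1&H2&H3). simpl.
        rewrite length_map. repeat split; [easy| |easy]. apply HA; [lra|easy].
      * now rewrite map_map.
      * intros i Hi. rewrite nth_scale, Hx, map_map, <- rsum_map_scal by easy.
        apply rsum_map_ext. intros wp _. cbn [fst snd]. rewrite nth_scale. ring.
Qed.

(** Each point of the combination is approximated and the weights are kept; since they sum to 1, the
    errors average to at most [d]. *)
Lemma conv_closure (N : nat) (A : list R -> Prop) (x : list R) (d : R) : 0 < d ->
  conv N (closure N A) x -> exists z, conv N A z /\ forall i, (i < N)%nat ->
    Rabs (nth i x 0 - nth i z 0) <= d.
Proof.
  intros Hd (Hl&ps&Hps&Hs&Hx).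
  assert (exists qs, Forall (fun wp => 0 <= fst wp /\ A (snd wp) /\ length (snd wp) = N) qs /\
            Forall2 (fun q p => fst q = fst p /\ close N d (snd p) (snd q)) qs ps) as (qs&Hqs&H2).
  { clear Hs Hx. induction Hps as [|[w p] ps (H1&H2&H3) _ (qs&Hqs&H)].
    - exists []. split; constructor.
    - simpl in *. apply closure_close in H2. destruct H2 as [_ H2].
      destruct (H2 d Hd) as (y&Hy&Hly&Hpy). exists ((w, y) :: qs).
      split; constructor; simpl; auto. }
  assert (Hw : rsum (map fst qs) = rsum (map fst ps)).
  { clear - H2. induction H2 as [|q p qs ps [H _] _ IH]; [easy|]. simpl. now rewrite H, IH. }
  exists (vec N (fun i => rsum (map (fun wp => fst wp * nth i (snd wp) 0) qs))). split.
  - split; [apply length_vec|]. exists qs. repeat split; [easy|lra|].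
    intros i Hi. now rewrite nth_vec.
  - intros i Hi. rewrite nth_vec, Hx by easy.
    replace d with (rsum (map fst qs) * d) by (rewrite Hw, Hs; ring).
    clear - H2 Hqs Hi. induction H2 as [|q p qs ps [Hqp Hc] _ IH].
    + simpl. rewrite Rminus_diag, Rabs_R0. lra.
    + inversion Hqs as [|? ? (H1&_&_) Hqs']; subst. cbn [map].
      change (rsum (?a :: ?l)) with (a + rsum l).
      specialize (IH Hqs'). specialize (Hc i Hi). rewrite <- Hqp.
      match goal with |- Rabs (?a * ?u + ?s - (?a * ?v + ?t)) <= _ =>
        replace (a * u + s - (a * v + t)) with (a * (u - v) + (s - t)) by ring end.
      eapply Rle_trans; [apply Rabs_triang|]. rewrite Rabs_mult, (Rabs_right (fst q)) by lra. nra.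
Qed.

(** * Homogenization *)

Lemma peval_local (N : nat) (p : mpoly) (x y : list R) : poly_in N p ->
  (forall i, (i < N)%nat -> nth i x 0 = nth i y 0) -> peval p x = peval p y.
Proof.
  intros Hp Hxy. rewrite !peval_rsum. apply rsum_map_ext. intros m Hm. f_equal.
  unfold poly_in in Hp. rewrite Forall_forall in Hp. specialize (Hp m Hm). cbn beta in Hp.
  unfold meval. f_equal. apply map_ext_in. intros i Hi%in_seq. rewrite Hxy; [easy|lia].
Qed.

Lemma poly_in_exists (p : mpoly) : exists N, poly_in N p.
Proof.
  induction p as [|m p [N IH]]; [exists 0%nat; constructor|].
  exists (Nat.max N (length (snd m))). constructor; [lia|].
  eapply Forall_impl; [|exact IH]. cbn beta; intros; lia.
Qed.

Lemma polyfun_peval (N : nat) (p : mpoly) : poly_in N p -> polyfun N (peval p).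
Proof.
  intros Hp. apply (polyfun_peval_with N (fun x => x)). intros m i Hm Hi.
  unfold poly_in in Hp. rewrite Forall_forall in Hp. specialize (Hp m Hm). cbn beta in Hp.
  apply polyfun_var. lia.
Qed.

Lemma meval_scale (c : R) (a : list nat) (x : list R) :
  meval a (map (Rmult c) x) = c ^ mdeg a * meval a x.
Proof.
  revert x. induction a as [|k a IH]; intros x; [unfold meval; simpl; ring|].
  rewrite !meval_cons, nth_scale, Rpow_mult_distr.
  replace (tl (map (Rmult c) x)) with (map (Rmult c) (tl x)) by now destruct x.
  rewrite IH. cbn [mdeg fold_right]. rewrite pow_add. unfold mdeg. ring.
Qed.

Lemma homogenize_scale (d : nat) (q : mpoly) (c : R) (y : list R) :
  Forall (fun m => (mdeg (snd m) <= d)%nat) q ->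
  peval (homogenize d q) (map (Rmult c) y) = c ^ d * peval (homogenize d q) y.
Proof.
  intros Hq. rewrite !peval_rsum, <- rsum_map_scal. unfold homogenize. rewrite !map_map.
  apply rsum_map_ext. intros m Hm. rewrite Forall_forall in Hq. specialize (Hq m Hm).
  cbn [fst snd] in *. rewrite meval_scale.
  replace (mdeg ((d - mdeg (snd m))%nat :: snd m)) with d; [ring|].
  unfold mdeg in *. cbn [fold_right]. lia.
Qed.

Lemma homogenize_one (d : nat) (q : mpoly) (x : list R) :
  peval (homogenize d q) (1 :: x) = peval q x.
Proof.
  rewrite !peval_rsum. unfold homogenize. rewrite map_map. apply rsum_map_ext.
  intros m _. cbn [fst snd]. rewrite meval_cons. cbn [nth tl]. rewrite pow1. ring.
Qed.

(* The representative chosen for the homogenization may mention variables beyond [X_n] whose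
   contributions cancel; off [X_0 = 0] this is inherited from [f], and on [X_0 = 0] it follows
   by continuity. *)
Lemma homogenize_local (n d : nat) (f q : mpoly) (t : R) (x : list R) :
  poly_in n f -> peq f q -> Forall (fun m => (mdeg (snd m) <= d)%nat) q ->
  peval (homogenize d q) (t :: x) = peval (homogenize d q) (t :: vec n (fun i => nth i x 0)).
Proof.
  intros Hf Hfq Hq.
  assert (Hne : forall s, s <> 0 -> peval (homogenize d q) (s :: x) =
            peval (homogenize d q) (s :: vec n (fun i => nth i x 0))).
  { intros s Hs.
    assert (Hdiv : forall u, s :: u = map (Rmult s) (1 :: map (Rmult (/ s)) u)).
    { intros u. cbn [map]. rewrite map_map. f_equal; [ring|].
      symmetry. rewrite <- (map_id u) at 2. apply map_ext. intros r. field. easy. }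
    rewrite (Hdiv x), (Hdiv (vec n _)), !homogenize_scale, !homogenize_one by easy.
    rewrite <- !Hfq. f_equal. apply (peval_local n); [easy|]. intros i Hi.
    now rewrite !nth_scale, nth_vec. }
  destruct (Req_dec t 0) as [->|Ht]; [|auto].
  destruct (poly_in_exists (homogenize d q)) as [M HM].
  apply polyfun_peval in HM. set (F := peval (homogenize d q)) in *.
  apply NNPP. intros Hdiff. set (v := vec n (fun i => nth i x 0)) in *.
  set (e := Rabs (F (0 :: x) - F (0 :: v)) / 2).
  assert (He : 0 < e).
  { assert (0 < Rabs (F (0 :: x) - F (0 :: v))) by (apply Rabs_pos_lt; lra). unfold e. lra. }
  destruct (polyfun_continuous M F HM (0 :: x) e He) as (d1&Hd1&H1).
  destruct (polyfun_continuous M F HM (0 :: v) e He) as (d2&Hd2&H2).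
  set (s := Rmin d1 d2 / 2). pose proof (Rmin_l d1 d2). pose proof (Rmin_r d1 d2).
  assert (0 < Rmin d1 d2) by now apply Rmin_glb_lt.
  assert (Hclose : forall d u, s < d -> close M d (0 :: u) (s :: u)).
  { intros d' u Hd' [|i] Hi; cbn [nth].
    - rewrite Rabs_minus_sym, Rminus_0_r, Rabs_right; unfold s in *; lra.
    - rewrite Rminus_diag, Rabs_R0. unfold s in *; lra. }
  assert (K1 : Rabs (F (0 :: x) - F (s :: x)) < e) by (apply H1, Hclose; unfold s; lra).
  assert (K2 : Rabs (F (0 :: v) - F (s :: v)) < e) by (apply H2, Hclose; unfold s; lra).
  rewrite (Hne s) in K1 by (unfold s; lra). rewrite Rabs_minus_sym in K2.
  pose proof (Rabs_triang (F (0 :: x) - F (s :: v)) (F (s :: v) - F (0 :: v))) as Htri.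
  replace (F (0 :: x) - F (s :: v) + (F (s :: v) - F (0 :: v)))
    with (F (0 :: x) - F (0 :: v)) in Htri by ring.
  unfold e in *. lra.
Qed.

(** An interface that hides the representative inside [homog_of]: the geometric arguments use [F]
    through its values, never through its monomials. *)
Definition homogenizes (n : nat) (f F : mpoly) : Prop :=
  polyfun (S n) (peval F) /\ (forall x, peval F (1 :: x) = peval f x) /\
  exists d, forall c y, peval F (map (Rmult c) y) = c ^ d * peval F y.

Lemma homog_of_homogenizes (n : nat) (f F : mpoly) :
  poly_in n f -> homog_of f F -> homogenizes n f F.
Proof.
  intros Hf (q&d&_&Hfq&Hq&->). split; [|split].
  - eapply polyfun_ext.
    (* After truncation to [n + 1] coordinates every later variable is constantly 0, hence
       polynomial; [homogenize_local] shows that truncating does not change the value. *)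
    + apply (polyfun_peval_with (S n) (fun x => vec (S n) (fun i => nth i x 0)) (homogenize d q)).
      intros m i _ _. destruct (Nat.lt_ge_cases i (S n)) as [Hi|Hi].
      * eapply polyfun_ext; [apply (polyfun_var (S n) i Hi)|]. intros x. cbn beta. now rewrite nth_vec.
      * eapply polyfun_ext; [apply (polyfun_const (S n) 0)|]. intros x. cbn beta.
        rewrite nth_overflow; [easy|]. now rewrite length_vec.
    + intros x. cbn beta.
      assert (Hx : forall p, peval p x = peval p (nth 0 x 0 :: tl x)).
      { intros p. destruct (poly_in_exists p) as [M HM]. apply (peval_local M); [easy|].
        intros [|i] _; cbn [nth]; [easy|now rewrite nth_tl]. }
      rewrite Hx, (homogenize_local n d f q) by easy. f_equal.
      unfold vec. cbn [seq map]. f_equal. rewrite <- seq_shift, map_map.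
      apply map_ext. intros i. now rewrite nth_tl.
  - intros x. now rewrite homogenize_one, Hfq.
  - exists d. intros c y. now apply homogenize_scale.
Qed.

(** * Quadratic modules *)

Lemma sos_nonneg (N : nat) (s : mpoly) (x : list R) : sos N s -> 0 <= peval s x.
Proof.
  intros (qs&_&Hs). rewrite Hs, peval_psum, map_map. apply rsum_map_nonneg.
  intros q _. rewrite peval_pmul. nra.
Qed.

Lemma peval_combine (s0 : mpoly) (ss H : list mpoly) (x : list R) :
  peval (padd s0 (psum (map (fun sh => pmul (fst sh) (snd sh)) (combine ss H)))) x =
  peval s0 x + rsum (map (fun sh => peval (fst sh) x * peval (snd sh) x) (combine ss H)).
Proof.
  unfold padd. rewrite peval_app, peval_psum, map_map. f_equal. apply rsum_map_ext.
  intros; apply peval_pmul.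
Qed.

Lemma Qmod_nonneg (N k : nat) (H : list mpoly) (p : mpoly) (x : list R) :
  Qmod N k H p -> Forall (fun h => 0 <= peval h x) H -> 0 <= peval p x.
Proof.
  intros (s0&ss&Hs0&_&Hss&Hp) HH. rewrite Hp, peval_combine.
  pose proof (sos_nonneg N s0 x Hs0). clear Hp.
  assert (0 <= rsum (map (fun sh => peval (fst sh) x * peval (snd sh) x) (combine ss H))); [|lra].
  induction Hss as [|s h ss H [Hs _] _ IH]; [simpl; lra|].
  inversion HH; subst. cbn [combine map fst snd]. change (rsum (?a :: ?l)) with (a + rsum l).
  pose proof (sos_nonneg N s x Hs). specialize (IH ltac:(easy)). nra.
Qed.

Lemma Qmod_mono (N k k' : nat) (H : list mpoly) (p : mpoly) : (k <= k')%nat ->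
  Qmod N k H p -> Qmod N k' H p.
Proof.
  intros Hk (s0&ss&Hs0&Hd&Hss&Hp). exists s0, ss. repeat split; [easy| | |easy].
  - apply (deg_le_weaken _ (2 * k)); [lia|easy].
  - eapply Forall2_impl; [|exact Hss]. intros s h [H1 H2]. split; [easy|].
    apply (deg_le_weaken _ (2 * k)); [lia|easy].
Qed.

(** Any finite representation has some degree, so the order [k] can be read off afterwards. *)
Lemma Qmod_intro (N : nat) (H ss : list mpoly) (s0 p : mpoly) :
  sos N s0 -> Forall2 (fun s _ => sos N s) ss H ->
  (forall x, peval p x =
     peval s0 x + rsum (map (fun sh => peval (fst sh) x * peval (snd sh) x) (combine ss H))) ->
  exists k, (1 <= k)%nat /\ Qmod N k H p.
Proof.
  intros Hs0 Hss Hp.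
  assert (exists d, Forall2 (fun s h => sos N s /\ deg_le (pmul s h) d) ss H) as [d Hd].
  { clear Hp. induction Hss as [|s h ss H Hs _ [d IH]]; [exists 0%nat; constructor|].
    destruct (deg_le_exists (pmul s h)) as [d' Hd']. exists (d + d')%nat. constructor.
    - split; [easy|]. apply (deg_le_weaken _ d'); [lia|easy].
    - eapply Forall2_impl; [|exact IH]. intros s' h' [H1 H2]. split; [easy|].
      apply (deg_le_weaken _ d); [lia|easy]. }
  destruct (deg_le_exists s0) as [d0 Hd0].
  exists (S (d + d0)). split; [lia|]. exists s0, ss. repeat split; [easy| | |].
  - apply (deg_le_weaken _ d0); [lia|easy].
  - eapply Forall2_impl; [|exact Hd]. intros s h [H1 H2]. split; [easy|].
    apply (deg_le_weaken _ d); [lia|easy].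
  - intros x. now rewrite Hp, peval_combine.
Qed.

Lemma sosfun_repr (N : nat) (f : list R -> R) : sosfun N f ->
  exists s, sos N s /\ forall x, peval s x = f x.
Proof.
  intros Hf. destruct (polyfun_repr N f (sosfun_polyfun N f Hf)) as (s&_&Hs).
  exists s. split; [|easy]. now apply (sosfun_sos N f).
Qed.

Lemma linform_in_Qmod (n : nat) (gt : list mpoly) (a : list R) :
  Forall (fun F => polyfun (S n) (peval F)) gt -> length a = S n ->
  (forall y, St_c n gt y -> normsqr (S n) y = 1 -> 0 < dot (S n) a y) ->
  exists k, (1 <= k)%nat /\ Qmod (S n) k (Gt n gt) (linform a).
Proof.
  intros Hgt Hla Hpos. set (N := S n) in *. rewrite Forall_forall in Hgt.
  (* The two sphere generators are left out: they enter through the remainder [r] of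
     [putinar_sphere]. *)
  set (G := gt ++ [[(1, [1%nat])]]).
  assert (HX0 : forall x, peval [(1, [1%nat])] x = nth 0 x 0).
  { intros x. unfold peval, meval. simpl. ring. }
  assert (HG : forall F, In F G -> polyfun N (peval F)).
  { intros F HF. apply in_app_iff in HF. destruct HF as [HF|[<-|[]]]; [auto|].
    eapply polyfun_ext; [apply (polyfun_var N 0); unfold N; lia|]. intros x. now rewrite HX0. }
  destruct (putinar_sphere N (dot N a) (map peval G)) as (s&r&m&Hs&Hr&Hm&Heq).
  - apply polyfun_dot.
  - intros h Hh. apply in_map_iff in Hh. destruct Hh as (F&<-&HF). auto.
  - intros y Hl Hn Hy. apply Hpos; [|easy]. split; [easy|]. split.
    + apply Forall_forall. intros F HF. apply Hy, in_map, in_app_iff. now left.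
    + rewrite <- HX0. apply Hy, in_map, in_app_iff. right. now left.
  - destruct (sosfun_repr N s Hs) as (s0&Hs0&Hs0e).
    assert (exists ss, Forall2 (fun s F => sos N s /\ forall x, peval s x = m (peval F) x) ss G)
      as [ss Hss].
    { assert (HmG : forall F, In F G -> sosfun N (m (peval F))) by (intros; apply Hm; now apply in_map).
      clear - HmG. induction G as [|F G IH]; [exists []; constructor|].
      destruct IH as [ss IH]; [auto with datatypes|].
      destruct (sosfun_repr N (m (peval F))) as (s&Hs&Hse); [auto with datatypes|].
      exists (s :: ss). now constructor. }
    (* [r = ((r + 1) / 2)^2 - ((r - 1) / 2)^2]: the first square multiplies [|x|^2 - 1], the second
       [1 - |x|^2]. *)
    assert (Hc : forall c, sosfun N (fun x => (/2 * (r x + c)) * (/2 * (r x + c)))).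
    { intros c. apply sosfun_sq. apply polyfun_scal, polyfun_add; [easy|apply polyfun_const]. }
    destruct (sosfun_repr N _ (Hc 1)) as (s1&Hs1&Hs1e).
    destruct (sosfun_repr N _ (Hc (-1))) as (s2&Hs2&Hs2e).
    replace (Gt n gt) with (G ++ [padd (normsq N) (pconst (-1));
      padd (pconst 1) (pscale (-1) (normsq N))]) by (unfold G, Gt; now rewrite <- app_assoc).
    apply (Qmod_intro N _ (ss ++ [s1; s2]) s0); [easy| |].
    + apply Forall2_app; [|now repeat constructor].
      eapply Forall2_impl; [|exact Hss]. now intros ? ? [? _].
    + intros x. rewrite peval_linform, Hla, Heq, Hs0e, map_map.
      assert (Hcomb : rsum (map (fun sh => peval (fst sh) x * peval (snd sh) x)
                (combine (ss ++ [s1; s2]) (G ++ [padd (normsq N) (pconst (-1));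
                   padd (pconst 1) (pscale (-1) (normsq N))])))
              = rsum (map (fun F => m (peval F) x * peval F x) G) + r x * (normsqr N x - 1)).
      { clear - Hss Hs1e Hs2e. induction Hss as [|s F ss G [_ HsF] _ IH].
        - cbn [combine app map fst snd rsum fold_right]. unfold padd.
          rewrite !peval_app, peval_pscale, !peval_pconst, peval_normsq, Hs1e, Hs2e. field.
        - cbn [combine app map fst snd]. change (rsum (?a :: ?l)) with (a + rsum l).
          rewrite IH, HsF. ring. }
      rewrite Hcomb. ring.
Qed.

(** * Theta bodies *)

Lemma normsqr_scale (N : nat) (c : R) (x : list R) :
  normsqr N (map (Rmult c) x) = c ^ 2 * normsqr N x.
Proof.
  unfold normsqr. rewrite <- bsum_scal. apply bsum_ext. intros i _. rewrite nth_scale. ring.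
Qed.

Lemma St_o_scale (n : nat) (g gt : list mpoly) (t : R) (y : list R) :
  Forall2 (homogenizes n) g gt -> 0 < t -> St_o n gt y -> St_o n gt (map (Rmult t) y).
Proof.
  intros Hgt Ht (Hl&Hy&H0). split; [now rewrite length_map|]. split.
  - clear - Hgt Ht Hy. induction Hgt as [|f F g gt (_&_&d&Hd) _ IH]; [constructor|].
    inversion Hy; subst. constructor; [|auto]. rewrite Hd. apply Rmult_le_pos; [|easy].
    apply pow_le; lra.
  - rewrite nth_scale. now apply Rmult_lt_0_compat.
Qed.

Lemma St_o_lift (n : nat) (g gt : list mpoly) (x : list R) :
  Forall2 (homogenizes n) g gt -> Sset n g x -> St_o n gt (1 :: x).
Proof.
  intros Hgt [Hl Hx]. split; [simpl; lia|]. split; [|simpl; lra].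
  induction Hgt as [|f F g gt (_&H1&_) _ IH]; [constructor|].
  inversion Hx; subst. constructor; [now rewrite H1|auto].
Qed.

Lemma Sset_of_St_o (n : nat) (g gt : list mpoly) (z : list R) :
  Forall2 (homogenizes n) g gt -> St_o n gt z ->
  Sset n g (vec n (fun i => nth (S i) z 0 / nth 0 z 0)).
Proof.
  intros Hgt Hz. assert (H0 : 0 < nth 0 z 0) by apply Hz.
  apply (St_o_scale n g gt (/ nth 0 z 0)) in Hz; [|easy|now apply Rinv_0_lt_compat].
  replace (map (Rmult (/ nth 0 z 0)) z)
    with (1 :: vec n (fun i => nth (S i) z 0 / nth 0 z 0)) in Hz.
  - destruct Hz as (Hl&Hz&_). split; [apply length_vec|].
    clear - Hgt Hz. induction Hgt as [|f F g gt (_&H1&_) _ IH]; [constructor|].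
    inversion Hz; subst. constructor; [now rewrite <- H1|auto].
  - destruct Hz as (Hl&_&_). apply (vector_ext (S n)); [simpl; now rewrite length_vec|easy|].
    intros [|i] Hi; rewrite nth_scale; cbn [nth].
    + field. lra.
    + rewrite nth_vec by lia. unfold Rdiv. ring.
Qed.

(** The point [(1, x)] need not satisfy the sphere generators, so it is scaled to norm 1;
    homogeneity of the constraints and of the form keeps all signs. *)
Lemma linform_nonneg (n k : nat) (g gt : list mpoly) (a x : list R) :
  Forall2 (homogenizes n) g gt -> length a = S n ->
  Qmod (S n) k (Gt n gt) (linform a) -> Sset n g x -> 0 <= dot (S n) a (1 :: x).
Proof.
  intros Hgt Hla HQ Hx. pose proof (St_o_lift n g gt x Hgt Hx) as Hy.
  set (y := 1 :: x) in *. set (v := normsqr (S n) y).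
  assert (Hv : 0 < v).
  { apply Rlt_le_trans with (nth 0 y 0 ^ 2); [simpl; lra|].
    apply (bsum_ge_term (S n) 0 (fun i => nth i y 0 ^ 2)); [|lia]. intros; apply pow2_ge_0. }
  pose proof (sqrt_lt_R0 v Hv) as Hsq. set (c := / sqrt v).
  assert (Hc : 0 < c) by now apply Rinv_0_lt_compat.
  apply (St_o_scale n g gt c y Hgt Hc) in Hy. destruct Hy as (Hl&Hy&H0).
  assert (Hn : normsqr (S n) (map (Rmult c) y) = 1).
  { rewrite normsqr_scale. fold v. rewrite <- (pow2_sqrt v) at 1 by lra.
    unfold c. field. lra. }
  assert (0 <= dot (S n) a (map (Rmult c) y)).
  { rewrite <- Hla at 1. rewrite <- peval_linform. apply (Qmod_nonneg _ _ _ _ _ HQ).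
    apply Forall_app. split; [easy|]. repeat (apply Forall_cons || apply Forall_nil).
    - unfold peval, meval; simpl in *; lra.
    - unfold padd. rewrite peval_app, peval_normsq, peval_pconst, Hn. lra.
    - unfold padd. rewrite peval_app, peval_pscale, peval_normsq, peval_pconst, Hn. lra. }
  rewrite dot_scale in *. nra.
Qed.

(** The form at [(1, y)] is affine in [y], so its sign passes to convex combinations and to
    limits. *)
Lemma nonneg_closure_conv (n : nat) (A : list R -> Prop) (a x : list R) :
  (forall y, A y -> 0 <= dot (S n) a (1 :: y)) ->
  closure n (conv n A) x -> 0 <= dot (S n) a (1 :: x).
Proof.
  intros HA Hx. apply closure_close in Hx. destruct Hx as [_ Hx].
  assert (Hconv : forall y, conv n A y -> 0 <= dot (S n) a (1 :: y)).
  { intros y (Hl&ps&Hps&Hs&Hy).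
    rewrite (dot_rsum (S n) a (1 :: y) fst (fun wp => 1 :: snd wp) ps).
    - apply rsum_map_nonneg. intros wp Hwp. rewrite Forall_forall in Hps.
      destruct (Hps wp Hwp) as (H1&H2&_). apply Rmult_le_pos; auto.
    - intros [|i] Hi; cbn [nth]; [|apply Hy; lia].
      etransitivity; [symmetry; exact Hs|]. apply rsum_map_ext. intros; ring. }
  apply Rnot_lt_le. intros Hlt.
  destruct (polyfun_continuous (S n) _ (polyfun_dot (S n) a) (1 :: x) (- dot (S n) a (1 :: x)))
    as (d&Hd&Hc); [lra|].
  destruct (Hx d Hd) as (y&Hy&_&Hxy). specialize (Hc (1 :: y)).
  assert (Hclose : close (S n) d (1 :: x) (1 :: y)).
  { intros [|i] Hi; cbn [nth]; [now rewrite Rminus_diag, Rabs_R0|apply Hxy; lia]. }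
  apply Hc, Rabs_def2 in Hclose. specialize (Hconv y Hy). lra.
Qed.

(* Dehomogenization divides by the [X_0]-coordinate, which is close to 1 near [(1, x)]. *)
Lemma closure_conv_of_cone (n : nat) (g gt : list mpoly) (x : list R) :
  Forall2 (homogenizes n) g gt -> length x = n ->
  conv (S n) (closure (S n) (St_o n gt)) (1 :: x) -> closure n (conv n (Sset n g)) x.
Proof.
  intros Hgt Hl HK. apply closure_close. split; [easy|]. intros d Hd.
  set (B := bsum n (fun i => Rabs (nth i x 0))).
  assert (HB : forall i, (i < n)%nat -> Rabs (nth i x 0) <= B).
  { intros i Hi. apply (bsum_ge_term n i (fun i => Rabs (nth i x 0))); [|easy].
    intros; apply Rabs_pos. }
  assert (HB0 : 0 <= B) by (apply bsum_nonneg; intros; apply Rabs_pos).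
  (* The bound [1/2] keeps [z0 >= 1/2], so dividing by it at most doubles errors; the other bound
     makes the final error [2 (B + 1) h] at most [d / 2]. *)
  set (h := Rmin (/ 2) (d / (4 * (B + 1)))).
  assert (Hh : 0 < h) by (apply Rmin_glb_lt; [lra|apply Rdiv_lt_0_compat; lra]).
  assert (Hh2 : h <= / 2) by apply Rmin_l.
  assert (HhB : h * (4 * (B + 1)) <= d).
  { apply Rle_trans with (d / (4 * (B + 1)) * (4 * (B + 1))); [|right; field; lra].
    apply Rmult_le_compat_r; [lra|apply Rmin_r]. }
  destruct (conv_closure (S n) _ _ h Hh HK) as (z&(Hlz&ps&Hps&Hs&Hz)&Hclose).
  rewrite Forall_forall in Hps.
  pose proof (Hclose 0%nat ltac:(lia)) as Hz0. cbn [nth] in Hz0.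
  set (z0 := nth 0 z 0) in *. apply Rabs_le_inv in Hz0.
  exists (vec n (fun i => nth (S i) z 0 / z0)). split; [|split].
  - split; [apply length_vec|].
    (* Central projection respects convex combinations once each weight is multiplied by the
       [X_0]-coordinate of its point and divided by [z0]. The new weights sum to 1 because [z0] is
       the weighted sum of those coordinates. *)
    exists (map (fun wp => (fst wp * nth 0 (snd wp) 0 / z0,
                  vec n (fun i => nth (S i) (snd wp) 0 / nth 0 (snd wp) 0))) ps).
    split; [|split].
    + apply Forall_map, Forall_forall. intros wp Hwp. destruct (Hps wp Hwp) as (H1&H2&H3).
      cbn [fst snd]. repeat split; [|apply length_vec|apply (Sset_of_St_o n g gt); auto|apply length_vec].
      assert (0 < nth 0 (snd wp) 0) by apply H2.
      apply Rmult_le_pos; [nra|]. apply Rlt_le, Rinv_0_lt_compat. lra.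
    + rewrite map_map. cbn [fst].
      rewrite (rsum_map_ext _ (fun wp => / z0 * (fst wp * nth 0 (snd wp) 0)))
        by (intros; unfold Rdiv; ring).
      rewrite rsum_map_scal, <- Hz by lia. fold z0. field. lra.
    + intros i Hi. rewrite nth_vec, map_map by easy. cbn [fst snd].
      rewrite Hz by lia. unfold Rdiv at 1. rewrite Rmult_comm, <- rsum_map_scal.
      apply rsum_map_ext. intros wp Hwp. destruct (Hps wp Hwp) as (_&(_&_&H2)&_).
      rewrite nth_vec by easy. field. lra.
  - apply length_vec.
  - intros i Hi. rewrite nth_vec by easy. specialize (HB i Hi).
    pose proof (Hclose (S i) ltac:(lia)) as Hzi. cbn [nth] in Hzi.
    replace (nth i x 0 - nth (S i) z 0 / z0)
      with ((nth i x 0 * (z0 - 1) + (nth i x 0 - nth (S i) z 0)) * / z0) by (field; lra).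
    rewrite Rabs_mult, (Rabs_right (/ z0)) by (apply Rle_ge, Rlt_le, Rinv_0_lt_compat; lra).
    assert (Hnum : Rabs (nth i x 0 * (z0 - 1) + (nth i x 0 - nth (S i) z 0)) <= (B + 1) * h).
    { eapply Rle_trans; [apply Rabs_triang|]. rewrite Rabs_mult.
      assert (Rabs (z0 - 1) <= h) by (apply Rabs_le; lra).
      assert (Rabs (nth i x 0) * Rabs (z0 - 1) <= B * h)
        by (apply Rmult_le_compat; auto using Rabs_pos). lra. }
    assert (Hi2 : / z0 <= 2).
    { rewrite <- (Rinv_inv 2). apply Rinv_le_contravar; lra. }
    assert (0 < / z0) by (apply Rinv_0_lt_compat; lra).
    apply Rle_lt_trans with ((B + 1) * h * 2); [|nra].
    apply Rmult_le_compat; [apply Rabs_pos|lra|easy|easy].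
Qed.

Lemma separating_linform (n : nat) (g gt : list mpoly) (x : list R) :
  Forall2 (homogenizes n) g gt -> assumptionA n gt -> length x = n ->
  ~ closure n (conv n (Sset n g)) x ->
  exists a, length a = S n /\ dot (S n) a (1 :: x) < 0 /\
    forall y, St_c n gt y -> normsqr (S n) y = 1 -> 0 < dot (S n) a y.
Proof.
  intros Hgt (Hinf&Hcl&Hpt) Hl Hx.
  destruct (classic (exists y, St_o n gt y)) as [[y0 Hy0]|Hempty].
  - set (A := closure (S n) (St_o n gt)) in *.
    assert (Hcone : convex_cone (S n) (conv (S n) A)).
    { apply conv_cone.
      - intros t y Ht Hy. apply closure_scale; auto. intros; now apply (St_o_scale n g gt).
      (* The origin is the limit of [t y0] as [t] tends to 0. This is why the empty case is
         separate: without a point of [St_o] the closure does not contain the origin. *)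
      - apply closure_close. split; [apply length_vec|]. intros d Hd.
        set (b := bsum (S n) (fun i => Rabs (nth i y0 0))).
        assert (Hb : 0 <= b) by (apply bsum_nonneg; intros; apply Rabs_pos).
        set (t := d / (b + 1)). assert (Ht : 0 < t) by (apply Rdiv_lt_0_compat; lra).
        assert (Htb : t * (b + 1) = d) by (unfold t; field; lra).
        exists (map (Rmult t) y0). split; [now apply (St_o_scale n g gt)|].
        split; [rewrite length_map; apply Hy0|]. intros i Hi.
        rewrite nth_vec, nth_scale by easy.
        rewrite Rminus_0_l, Rabs_Ropp, Rabs_mult, (Rabs_right t) by lra.
        assert (Rabs (nth i y0 0) <= b).
        { apply (bsum_ge_term (S n) i (fun i => Rabs (nth i y0 0))); [|easy].
          intros; apply Rabs_pos. }
        nra. }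
    destruct (strict_separation (S n) (conv (S n) A) (1 :: x)) as (a&Hla&Ha&Hax); auto.
    { simpl; lia. }
    { intros HK. apply Hx. now apply (closure_conv_of_cone n g gt). }
    exists a. repeat split; auto. intros y Hy Hn. apply Ha; [|easy].
    apply conv_intro; [now apply Hinf|apply Hy].
  (* If [St_o] is empty, so is [St_c], by closedness at infinity. The form [-X_0] is then vacuously
     positive on it and equals -1 at [(1, x)]. *)
  - exists (vec (S n) (fun i => if Nat.eqb i 0 then -1 else 0)). split; [apply length_vec|].
    split.
    + unfold dot. rewrite (bsum_split_term (S n) 0) by lia. rewrite (bsum_ext (S n) _ (fun _ => 0)).
      * rewrite bsum_const, nth_vec by lia. simpl. lra.
      * intros i Hi. destruct (Nat.eqb_spec i 0) as [->|Hne]; [easy|].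
        rewrite nth_vec by easy. destruct (Nat.eqb_spec i 0); [easy|ring].
    + intros y Hy. apply Hinf in Hy. destruct Hy as [_ Hy].
      destruct (Hy 1 ltac:(lra)) as (z&Hz&_). exfalso. apply Hempty. now exists z.
Qed.

Theorem mainTheorem6 (n : nat) (g gt : list mpoly)
  (Hg : Forall (poly_in n) g)
  (Hgt : Forall2 homog_of g gt)
  (HA : assumptionA n gt) :
  (forall k : nat, (1 <= k)%nat ->
     forall x, closure n (conv n (Sset n g)) x -> THk n gt k x) /\
  (forall k : nat, (1 <= k)%nat ->
     forall x, THk n gt (S k) x -> THk n gt k x) /\
  set_eq (closure n (conv n (Sset n g)))
         (fun x => length x = n /\ forall k : nat, (1 <= k)%nat -> THk n gt k x).
Proof.
  assert (Hh : Forall2 (homogenizes n) g gt).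
  { clear HA. induction Hgt as [|f F g gt HfF _ IH]; [constructor|].
    inversion Hg; subst. constructor; [now apply homog_of_homogenizes|auto]. }
  assert (Hsub : forall k x, closure n (conv n (Sset n g)) x -> THk n gt k x).
  { intros k x Hx. split; [apply Hx|]. intros a Hla HQ. rewrite peval_linform, Hla.
    apply (nonneg_closure_conv n (Sset n g)); [|easy].
    intros y Hy. now apply (linform_nonneg n k g gt). }
  split; [auto|]. split.
  - intros k _ x [Hl H]. split; [easy|]. intros a Hla HQ. apply H; [easy|].
    apply (Qmod_mono (S n) k); [lia|easy].
  - intros x. split.
    + intros Hx. split; [apply Hx|auto].
    + intros [Hl Hx]. apply NNPP. intros Hn.
      destruct (separating_linform n g gt x Hh HA Hl Hn) as (a&Hla&Hax&Ha).
      (* The order [k] depends on the form [a], hence on [x]: each outside point is excluded at its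
         own level, which yields the intersection and no single body. *)
      destruct (linform_in_Qmod n gt a) as (k&Hk&HQ); [|easy|easy|].
      { clear - Hh. induction Hh as [|f F g gt (HF&_) _ IH]; now constructor. }
      destruct (Hx k Hk) as [_ HT]. specialize (HT a Hla HQ).
      rewrite peval_linform, Hla in HT. lra.
Qed.
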